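(* Let $E$ be an elliptic curve over $\mathbb{Q}$ whose Mordell–Weil group $E(\mathbb{Q})$ has rank $r\ge 2$, and let $\Gamma$ be a subgroup of $E(\mathbb{Q})$ of rank $s$ with $1\le s<r$. Then for every sufficiently large real $x$ there is a rational point $Q\in E(\mathbb{Q})$ with $$\hat{h}(Q)\le \exp\Big(\frac{4}{s+2}x+O(x/\log x)\Big)$$ such that $Q$ is an $x$-pseudolinearly dependent point of $\Gamma$.
   Context: For a prime $p$ of good reduction of $E$ (i.e. $p\nmid \Delta_E$), $\Gamma_p\subseteq E(\mathbb{F}_p)$ denotes the image of $\Gamma$ under reduction modulo $p$. A point $Q\in E(\mathbb{Q})$ is an $x$-pseudolinearly dependent point of $\Gamma$ if $Q\notin\Gamma$ but, for every prime $p\le x$ of good reduction, the reduction of $Q$ modulo $p$ lies in $\Gamma_p$. $\hat{h}$ denotes the canonical (Néron–Tate) height on $E(\mathbb{Q})$. The implied constant in $O$ depends only on $E$ and $\Gamma$. *)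

(* Defs.v *)
From HB Require Import structures.
From mathcomp Require Import all_boot all_order all_algebra.
From mathcomp Require Import all_classical all_reals all_analysis.
From mathcomp Require Import ring.

Set Implicit Arguments.
Unset Strict Implicit.
Unset Printing Implicit Defensive.

Import Order.TTheory GRing.Theory Num.Theory.
Import numFieldNormedType.Exports.

Local Open Scope classical_set_scope.
Local Open Scope ring_scope.

(* The curve y^2 + a1 x y + a3 y = x^3 + a2 x^2 + a4 x + a6. *)
Record weierstrass (A : Type) :=
  Weierstrass { a1 : A; a2 : A; a3 : A; a4 : A; a6 : A }.

Definition disc (A : comNzRingType) (W : weierstrass A) : A :=
  let b2 := a1 W ^+ 2 + 4 * a2 W in
  let b4 := 2 * a4 W + a1 W * a3 W in
  let b6 := a3 W ^+ 2 + 4 * a6 W in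
  let b8 := a1 W ^+ 2 * a6 W + 4 * a2 W * a6 W - a1 W * a3 W * a4 W
            + a2 W * a3 W ^+ 2 - a4 W ^+ 2 in
  - b2 ^+ 2 * b8 - 8 * b4 ^+ 3 - 27 * b6 ^+ 2 + 9 * b2 * b4 * b6.

Definition base_change (K : nzRingType) (W : weierstrass int) : weierstrass K :=
  Weierstrass (a1 W)%:~R (a2 W)%:~R (a3 W)%:~R (a4 W)%:~R (a6 W)%:~R.

(* W and W' are related by x = u^2 x' + r, y = u^3 y' + u^2 s x' + t. *)
Definition isomorphic_over_rat (W W' : weierstrass int) : Prop :=
  let V := base_change rat W in
  let V' := base_change rat W' in
  exists u r s t : rat,
    u != 0 /\
    u * a1 V' = a1 V + 2 * s /\
    u ^+ 2 * a2 V' = a2 V - s * a1 V + 3 * r - s ^+ 2 /\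
    u ^+ 3 * a3 V' = a3 V + r * a1 V + 2 * t /\
    u ^+ 4 * a4 V' = a4 V - s * a3 V + 2 * r * a2 V - (t + r * s) * a1 V
                     + 3 * r ^+ 2 - 2 * s * t /\
    u ^+ 6 * a6 V' = a6 V + r * a4 V + r ^+ 2 * a2 V + r ^+ 3
                     - t * a3 V - t ^+ 2 - r * t * a1 V.

(* An elliptic curve over Q is presented by a global minimal Weierstrass
   equation, so that disc E is the minimal discriminant and the primes of good
   reduction are exactly those not dividing it. *)
Definition minimal_elliptic (E : weierstrass int) : Prop :=
  disc E != 0 /\
  forall E' : weierstrass int, isomorphic_over_rat E E' ->
    `|disc E| <= `|disc E'|.

Inductive point (K : Type) := Infinity | Affine of K & K.
Arguments Infinity {K}.

Section GroupLaw.
Variables (K : fieldType) (W : weierstrass K).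

Definition on_curve (P : point K) : bool :=
  if P is Affine x y then
    y ^+ 2 + a1 W * x * y + a3 W * y
      == x ^+ 3 + a2 W * x ^+ 2 + a4 W * x + a6 W
  else true.

Definition raw_opp (P : point K) : point K :=
  if P is Affine x y then Affine x (- y - a1 W * x - a3 W) else Infinity.

(* Third intersection, reflected, of the curve with the line of slope l
   through (x1, y1) and a point of abscissa x2. *)
Definition chord (l x1 y1 x2 : K) : point K :=
  let x3 := l ^+ 2 + a1 W * l - a2 W - x1 - x2 in
  raw_opp (Affine x3 (l * (x3 - x1) + y1)).

Definition raw_add (P Q : point K) : point K :=
  match P, Q with
  | Infinity, _ => Q
  | _, Infinity => P
  | Affine x1 y1, Affine x2 y2 =>
    if x1 != x2 then chord ((y2 - y1) / (x2 - x1)) x1 y1 x2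
    else if y1 == - y2 - a1 W * x2 - a3 W then Infinity
    else chord ((3 * x1 ^+ 2 + 2 * a2 W * x1 + a4 W - a1 W * y1)
                / (2 * y1 + a1 W * x1 + a3 W)) x1 y1 x1
  end.

Lemma on_curve_opp P : on_curve P -> on_curve (raw_opp P).
Proof.
case: P => //= x y /eqP h; apply/eqP; rewrite -h; ring.
Qed.

Lemma on_curve_chord l x1 y1 x2 (al be : K) :
    (forall X, X ^+ 3 + a2 W * X ^+ 2 + a4 W * X + a6 W
       - ((l * (X - x1) + y1) ^+ 2 + a1 W * X * (l * (X - x1) + y1)
          + a3 W * (l * (X - x1) + y1))
     = (X - x1) * (X - x2) * (X - (l ^+ 2 + a1 W * l - a2 W - x1 - x2))
       + al * X + be) ->
    al = 0 -> be = 0 -> on_curve (chord l x1 y1 x2).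
Proof.
move=> h al0 be0; apply: on_curve_opp => /=.
rewrite eq_sym -subr_eq0 h al0 be0; apply/eqP; ring.
Qed.

Lemma on_curve_add P Q : on_curve P -> on_curve Q -> on_curve (raw_add P Q).
Proof.
case: P Q => [|x1 y1] [|x2 y2] // /eqP h1 /eqP h2.
rewrite /raw_add; case: eqVneq => [ex | nx] /=.
- subst x2; case: eqVneq => // ny.
  have {h2} ey : y1 = y2.
    apply/eqP; rewrite -subr_eq0.
    have : (y1 - y2) * (y1 - (- y2 - a1 W * x1 - a3 W)) == 0.
      apply/eqP; rewrite -[RHS](subrr (x1 ^+ 3 + a2 W * x1 ^+ 2 + a4 W * x1 + a6 W)).
      by rewrite -{1}h1 -h2; ring.
    by rewrite mulf_eq0 (subr_eq0 _ (_ - a3 W)) (negbTE ny) orbF.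
  subst y2.
  have nd : 2 * y1 + a1 W * x1 + a3 W != 0.
    apply: contraNneq ny => d0; rewrite -subr_eq0 -d0; apply/eqP; ring.
  set l := (_ / _).
  have hl : l * (2 * y1 + a1 W * x1 + a3 W)
            = 3 * x1 ^+ 2 + 2 * a2 W * x1 + a4 W - a1 W * y1.
    by rewrite /l mulfVK.
  move: l hl => l hl.
  pose x3 := l ^+ 2 + a1 W * l - a2 W - x1 - x1.
  pose al := a4 W - 2 * l * (y1 - l * x1) - a1 W * (y1 - l * x1) - a3 W * l
             - (x1 ^+ 2 + 2 * x1 * x3).
  pose be := a6 W - (y1 - l * x1) ^+ 2 - a3 W * (y1 - l * x1) + x1 ^+ 2 * x3.
  have al0 : al = 0.
    have -> : al = 3 * x1 ^+ 2 + 2 * a2 W * x1 + a4 W - a1 W * y1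
                   - l * (2 * y1 + a1 W * x1 + a3 W) by rewrite /al /x3; ring.
    by rewrite hl subrr.
  have be0 : be = 0.
    have : al * x1 + be = 0.
      rewrite -[RHS](subrr (y1 ^+ 2 + a1 W * x1 * y1 + a3 W * y1)) {1}h1.
      by rewrite /al /be /x3; ring.
    by rewrite al0 mul0r add0r.
  apply: (on_curve_chord (al := al) (be := be)) => // X.
  by rewrite /al /be /x3; ring.
- set l := (_ / _).
  have hl : y2 = l * (x2 - x1) + y1.
    by rewrite /l mulfVK ?subrK // subr_eq0 eq_sym.
  move: l hl => l hl.
  pose x3 := l ^+ 2 + a1 W * l - a2 W - x1 - x2.
  pose al := a4 W - 2 * l * (y1 - l * x1) - a1 W * (y1 - l * x1) - a3 W * l
             - (x1 * x2 + (x1 + x2) * x3).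
  pose be := a6 W - (y1 - l * x1) ^+ 2 - a3 W * (y1 - l * x1) + x1 * x2 * x3.
  have e1 : al * x1 + be = 0.
    rewrite -[RHS](subrr (y1 ^+ 2 + a1 W * x1 * y1 + a3 W * y1)) {1}h1.
    by rewrite /al /be /x3; ring.
  have e2 : al * x2 + be = 0.
    rewrite -[RHS](subrr (y2 ^+ 2 + a1 W * x2 * y2 + a3 W * y2)) {1}h2.
    by rewrite /al /be /x3 hl; ring.
  have al0 : al = 0.
    have : al * (x1 - x2) = 0.
      by rewrite -[RHS](subrr (0 : K)) -{1}e1 -e2; ring.
    by move/eqP; rewrite mulf_eq0 [x1 - _ == 0]subr_eq0 (negbTE nx) orbF => /eqP.
  have be0 : be = 0 by move: e1; rewrite al0 mul0r add0r.
  apply: (on_curve_chord (al := al) (be := be)) => // X.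
  by rewrite /al /be /x3; ring.
Qed.

Definition ecpoint := {P : point K | on_curve P}.

Definition ec0 : ecpoint := Sub (Infinity : point K) (isT : on_curve Infinity).
Definition ecopp (P : ecpoint) : ecpoint :=
  Sub (raw_opp (val P)) (on_curve_opp (valP P)).
Definition ecadd (P Q : ecpoint) : ecpoint :=
  Sub (raw_add (val P) (val Q)) (on_curve_add (valP P) (valP Q)).

Definition ecmulz (P : ecpoint) (m : int) : ecpoint :=
  match m with
  | Posz n => iter n (ecadd P) ec0
  | Negz n => ecopp (iter n.+1 (ecadd P) ec0)
  end.

Definition subgroup (G : set ecpoint) : Prop :=
  [/\ G ec0, (forall P Q, G P -> G Q -> G (ecadd P Q))
    & forall P, G P -> G (ecopp P)].

Definition independent (n : nat) (P : 'I_n -> ecpoint) : Prop :=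
  forall m : 'I_n -> int,
    \big[ecadd/ec0]_(i < n) ecmulz (P i) (m i) = ec0 -> forall i, m i = 0.

Definition has_rank (G : set ecpoint) (n : nat) : Prop :=
  (exists P : 'I_n -> ecpoint, (forall i, G (P i)) /\ independent P) /\
  (forall k (P : 'I_k -> ecpoint),
     (forall i, G (P i)) -> independent P -> (k <= n)%N).

End GroupLaw.

Section Reduction.
Variables (E : weierstrass int) (p : nat).

Let EQ := base_change rat E.
Let EFp := base_change 'F_p E.

(* On an integral equation, p divides the denominator of x if and only if it
   divides that of y, in which case (x : y : 1) reduces to (0 : 1 : 0). For r
   with denominator prime to p, ratr r is the residue class of r in 'F_p. *)
Definition raw_reduce (P : point rat) : point 'F_p :=
  if P is Affine x y then
    if (p %| `|denq x|)%N then Infinity else Affine (ratr x) (ratr y)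
  else Infinity.

Lemma on_curve_reduce : prime p ->
  forall P, on_curve EQ P -> on_curve EFp (raw_reduce P).
Proof.
move=> pr [|x y] //=; case: ifPn => // pb /eqP h.
have intr0 (z : int) : (z%:~R == 0 :> 'F_p) = (p %| `|z|)%N.
  have F0 (n : nat) : (n%:R == 0 :> 'F_p) = (p %| n)%N.
    by rewrite -(dvdn_pcharf (pchar_Fp pr)).
  case: z => n; first by rewrite -F0.
  by rewrite NegzE mulrNz oppr_eq0 abszN -F0.
have nzQ (z : rat) : (denq z)%:~R != 0 :> rat by rewrite intr_eq0 denq_neq0.
rewrite -(divq_num_den x) -(divq_num_den y) in h.
have := coprime_num_den y; have := nzQ x; have := nzQ y; move: pb h.
rewrite /ratr; move: (numq x) (denq x) (numq y) (denq y) => a b c d pb h nd nb cop.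
have {h} key : c ^+ 2 * b ^+ 3 + a1 E * a * c * d * b ^+ 2
       + a3 E * c * d * b ^+ 3
     = a ^+ 3 * d ^+ 2 + a2 E * a ^+ 2 * b * d ^+ 2
       + a4 E * a * b ^+ 2 * d ^+ 2 + a6 E * b ^+ 3 * d ^+ 2.
  apply: (@intr_inj rat).
  have := congr1 (fun t => t * (b%:~R ^+ 3 * d%:~R ^+ 2)) h => /=.
  rewrite !(rmorphD, rmorphM, rmorphXn) /= => e.
  transitivity (((c%:~R / d%:~R) ^+ 2
       + (a1 E)%:~R * (a%:~R / b%:~R) * (c%:~R / d%:~R)
       + (a3 E)%:~R * (c%:~R / d%:~R)) * (b%:~R ^+ 3 * d%:~R ^+ 2) : rat).
    by field; rewrite nb nd.
  by rewrite e; field; rewrite nb.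
have keyF := congr1 (fun z : int => z%:~R : 'F_p) key.
rewrite !(rmorphD, rmorphM, rmorphXn) /= in keyF.
have nbF : b%:~R != 0 :> 'F_p by rewrite intr0.
have ndF : d%:~R != 0 :> 'F_p.
  apply/negP => d0; move: keyF; rewrite (eqP d0) => /eqP.
  rewrite !(mulr0, mul0r, addr0, expr0n) /= mulf_eq0 !expf_eq0 /=.
  rewrite (negbTE nbF) orbF intr0 => pc; move: d0; rewrite intr0 => pd.
  by have := dvdn_gcd p `|c| `|d|; rewrite pc pd (eqP cop) dvdn1; case: eqP pr => // ->.
apply/eqP/(mulIf (mulf_neq0 (expf_neq0 3 nbF) (expf_neq0 2 ndF))).
transitivity (c%:~R ^+ 2 * b%:~R ^+ 3 + (a1 E)%:~R * a%:~R * c%:~R * d%:~R * b%:~R ^+ 2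
       + (a3 E)%:~R * c%:~R * d%:~R * b%:~R ^+ 3 : 'F_p).
  by field; rewrite nbF ndF.
by rewrite keyF; field; rewrite nbF.
Qed.

Definition reduce (pr : prime p) (P : ecpoint EQ) : ecpoint EFp :=
  Sub (raw_reduce (val P)) (on_curve_reduce pr (valP P)).

End Reduction.

Section PseudolinearDependence.
Variables (R : realType) (E : weierstrass int).

Let EQ := base_change rat E.

Definition log_height (P : ecpoint EQ) : R :=
  if val P is Affine x _ then ln (Num.max `|numq x| (denq x))%:~R else 0.

(* Tate's limit, normalised with the factor 1/2. *)
Definition canonical_height (P : ecpoint EQ) : R :=
  lim ((fun n : nat =>
          log_height (iter n (fun T => ecadd T T) P) / (2 * 4 ^+ n)) @ \oo).

Definition pseudolinearly_dependent (G : set (ecpoint EQ)) (x : R)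
    (Q : ecpoint EQ) : Prop :=
  ~ G Q /\
  forall (p : nat) (pr : prime p), p%:R <= x -> ~~ (p %| `|disc E|)%N ->
    (reduce pr @` G) (reduce pr Q).

End PseudolinearDependence.

(* Main.v *)
(* Take P in E(Q) none of whose positive multiples lies in Gamma, and P0 in Gamma
   of infinite order; the point is Q = M P. For a good prime p <= x, the
   pigeonhole principle on the points i P0 + j P modulo p (i < a, j < b,
   a b > p + 1) gives a relation u P0 + v P = 0 modulo p with u = O(a) and
   v = O(x / a). If v <> 0, then v P, hence M P, reduces into Gamma_p as soon as
   v divides M. If v = 0, then p divides the denominator of x(u P0); since the
   height of u P0 is O(u^4), only O(a^5) primes are of this kind, and for each of
   them M may absorb some m <= 2 p + 2 with m P = 0 modulo p. So M can be the
   factorial of O(x / a) times a product of O(a^5) factors O(x); with a = x^(1/6)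
   this gives log M = O(x / log x), and the height of M P is O(M^4). The main term
   4 x / (s + 2) of the exponent is therefore not even needed, only its error
   term; neither the prime number theorem nor Hasse's bound enters.

   The group law: a point is sent to its ideal in the coordinate ring, and P + Q
   corresponds to the product of ideals up to principal factors. This map is
   injective, so associativity is inherited from ideals. *)

Require Import Defs.
From HB Require Import structures.
From mathcomp Require Import all_boot all_order all_algebra.
From mathcomp Require Import all_classical all_reals all_analysis.
From mathcomp Require Import ring lra zify.

Set Implicit Arguments.
Unset Strict Implicit.
Unset Printing Implicit Defensive.

Import Order.TTheory GRing.Theory Num.Theory.
Import numFieldNormedType.Exports.

Local Open Scope classical_set_scope.
Local Open Scope ring_scope.

(** * Ideals up to principal factors *)

Section Ideals.
Variable A : comNzRingType.
Implicit Types (a b : A) (I J L : set A).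

Definition ideal I : Prop :=
  [/\ I 0, (forall f g, I f -> I g -> I (f + g)) & forall f g, I g -> I (f * g)].

(* The smallest ideal containing all products: quantifying over ideals rather
   than writing finite sums makes associativity immediate. *)
Definition idmul I J : set A :=
  [set f | forall L, ideal L -> (forall a b, I a -> J b -> L (a * b)) -> L f].

Definition principal a : set A := [set f | exists g, f = a * g].

Lemma ideal_idmul I J : ideal (idmul I J).
Proof.
split=> [L [] //|f g hf hg L iL h|f g hg L iL h].
- by case: (iL) => _ hD _; apply: hD; [apply: hf | apply: hg].
- by case: (iL) => _ _ hM; apply: hM; apply: hg.
Qed.

Lemma ideal_principal a : ideal (principal a).
Proof.
split=> [|_ _ [f ->] [g ->]|f _ [g ->]].
- by exists 0; rewrite mulr0.
- by exists (f + g); rewrite mulrDr.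
- by exists (f * g); rewrite mulrCA.
Qed.

Lemma mem_idmul I J a b : I a -> J b -> idmul I J (a * b).
Proof. by move=> ha hb L _; apply. Qed.

Lemma idmul_sub I J L : ideal L ->
  (forall a b, I a -> J b -> L (a * b)) -> idmul I J `<=` L.
Proof. by move=> iL h f; apply. Qed.

Lemma idmulC I J : idmul I J = idmul J I.
Proof.
by apply/seteqP; split; apply: idmul_sub; try exact: ideal_idmul;
  move=> a b ha hb; rewrite mulrC; apply: mem_idmul.
Qed.

Lemma idmulA I J L : idmul I (idmul J L) = idmul (idmul I J) L.
Proof.
have sub I' J' L' : idmul (idmul I' J') L' `<=` idmul I' (idmul J' L').
  apply: idmul_sub; first exact: ideal_idmul.
  move=> a b ha hb; move: a ha.
  have [h0 hD hM] := ideal_idmul I' (idmul J' L').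
  apply: (idmul_sub (L := [set a | idmul I' (idmul J' L') (a * b)])) => /=.
  - split=> [|f g hf hg|f g hg] /=; first by rewrite mul0r.
      by rewrite mulrDl; apply: hD.
    by rewrite -mulrA; apply: hM.
  - by move=> f g hf hg; rewrite -mulrA; do 2?[apply: mem_idmul].
apply/seteqP; split; last exact: sub.
by rewrite idmulC -[idmul J L]idmulC (idmulC (idmul I J)) (idmulC I); apply: sub.
Qed.

Lemma idmul_principal a I : ideal I ->
  idmul (principal a) I = [set f | exists2 g, I g & f = a * g].
Proof.
move=> [h0 hD hM]; apply/seteqP; split; last first.
  move=> _ [g hg ->]; apply: mem_idmul => //; by exists 1; rewrite mulr1.
apply: idmul_sub.
  split=> [|_ _ [f hf ->] [g hg ->]|f _ [g hg ->]].
  - by exists 0; rewrite ?mulr0.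
  - by exists (f + g); [apply: hD | rewrite mulrDr].
  - by exists (f * g); [apply: hM | rewrite mulrCA].
by move=> _ b [f ->] hb; exists (f * b); [apply: hM | rewrite mulrA].
Qed.

Lemma principalM a b : idmul (principal a) (principal b) = principal (a * b).
Proof.
rewrite idmul_principal; last exact: ideal_principal.
apply/seteqP; split=> [_ [_ [f ->] ->]|_ [f ->]].
  by exists f; rewrite mulrA.
by exists (b * f); [exists f | rewrite mulrA].
Qed.

Lemma idmul1 I : ideal I -> idmul (principal 1) I = I.
Proof.
move=> iI; rewrite idmul_principal //; apply/seteqP; split=> [_ [g hg ->]|f hf].
  by rewrite mul1r.
by exists f; rewrite ?mul1r.
Qed.

Lemma ideal1 I : ideal I -> I 1 -> I = principal 1.
Proof.
move=> [_ _ hM] h1; apply/seteqP; split=> [f _|_ [f ->]].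
  by exists f; rewrite mul1r.
by rewrite mulrC; apply: hM.
Qed.

Lemma sub_principal a I : ideal I -> I `<=` principal a ->
  exists2 J, ideal J & I = idmul (principal a) J.
Proof.
move=> [h0 hD hM] sI.
have iJ : ideal [set f | I (a * f)].
  split=> [|f g hf hg|f g hg] /=; first by rewrite mulr0.
    by rewrite mulrDr; apply: hD.
  by rewrite mulrCA; apply: hM.
exists [set f | I (a * f)] => //.
rewrite idmul_principal //; apply/seteqP; split=> [f hf|_ [g hg ->] //].
by have [g eg] := sI f hf; exists g => //=; rewrite -eg.
Qed.

Definition regular a := forall f, a * f = 0 -> f = 0.

Lemma idmulI a I J : regular a -> ideal I -> ideal J ->
  idmul (principal a) I = idmul (principal a) J -> I = J.
Proof.
move=> ra iI iJ; rewrite !idmul_principal //.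
have sub (I' J' : set A) : [set f | exists2 g, I' g & f = a * g] =
    [set f | exists2 g, J' g & f = a * g] -> I' `<=` J'.
  move=> /seteqP [+ _] g hg => /(_ (a * g)) /=; case; first by exists g.
  move=> g' hg' /eqP; rewrite -subr_eq0 -mulrBr => /eqP /ra /eqP.
  by rewrite subr_eq0 => /eqP ->.
by move=> e; apply/seteqP; split; apply: sub.
Qed.

Lemma idmul_principal_mem a J g :
  regular a -> ideal J -> idmul (principal a) J (a * g) -> J g.
Proof.
move=> ra iJ; rewrite idmul_principal // => -[g' hg' /eqP].
by rewrite -subr_eq0 -mulrBr => /eqP /ra /eqP; rewrite subr_eq0 => /eqP ->.
Qed.

Lemma idmulACA I J L M :
  idmul (idmul I J) (idmul L M) = idmul (idmul I L) (idmul J M).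
Proof. by rewrite -!idmulA (idmulA J) (idmulC J L) !idmulA. Qed.

Lemma setT_principal : setT = principal 1.
Proof. by apply/seteqP; split=> // f _; exists f; rewrite mul1r. Qed.

Definition ideq I J : Prop := exists a b,
  [/\ regular a, regular b & idmul (principal a) I = idmul (principal b) J].

Lemma regularM a b : regular a -> regular b -> regular (a * b).
Proof. by move=> ra rb f; rewrite -mulrA => /ra /rb. Qed.

Lemma regular1 : regular 1. Proof. by move=> f; rewrite mul1r. Qed.

Lemma ideq_refl I : ideq I I.
Proof. by exists 1, 1; split=> //; exact: regular1. Qed.

Lemma ideq_sym I J : ideq I J -> ideq J I.
Proof. by move=> [a [b [ra rb e]]]; exists b, a. Qed.

Lemma ideq_trans J I L : ideq I J -> ideq J L -> ideq I L.
Proof.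
move=> [a [b [ra rb e]]] [c [d [rc rd e']]].
exists (c * a), (b * d); split; try exact: regularM.
by rewrite -!principalM -idmulA e idmulA (idmulC (principal c)) -idmulA e' idmulA.
Qed.

Lemma ideq_mull L I J : ideq I J -> ideq (idmul L I) (idmul L J).
Proof.
move=> [a [b [ra rb e]]]; exists a, b; split=> //.
by rewrite !(idmulC L) !idmulA e.
Qed.

End Ideals.

(** * The coordinate ring of a Weierstrass curve *)

(* (p, q) stands for p + q Y in K[X, Y] / (Y^2 + trace Y - cubic). *)
Definition coordring (K : fieldType) (W : weierstrass K) : Type :=
  ({poly K} * {poly K})%type.

Section CoordinateRing.
Variables (K : fieldType) (W : weierstrass K).

HB.instance Definition _ :=
  GRing.Zmodule.copy (coordring W) ({poly K} * {poly K})%type.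

Definition cubic : {poly K} := 'X^3 + (a2 W)%:P * 'X^2 + (a4 W)%:P * 'X + (a6 W)%:P.
Definition trace : {poly K} := (a1 W)%:P * 'X + (a3 W)%:P.

Definition coord_one : coordring W := (1, 0).
Definition coord_mul (f g : coordring W) : coordring W :=
  (f.1 * g.1 + f.2 * g.2 * cubic, f.1 * g.2 + f.2 * g.1 - f.2 * g.2 * trace).

Lemma coordP (f g : coordring W) : f.1 = g.1 -> f.2 = g.2 -> f = g.
Proof. by case: f g => [? ?] [? ?] /= -> ->. Qed.

Lemma coord_mulA : associative coord_mul.
Proof. by move=> f g h; apply: coordP; rewrite /=; ring. Qed.
Lemma coord_mulC : commutative coord_mul.
Proof. by move=> f g; apply: coordP; rewrite /=; ring. Qed.
Lemma coord_mul1 : left_id coord_one coord_mul.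
Proof. by move=> f; apply: coordP; rewrite /=; ring. Qed.
Lemma coord_mulDl : left_distributive coord_mul +%R.
Proof. by move=> f g h; apply: coordP; rewrite /=; ring. Qed.
Lemma coord_one_neq0 : coord_one != 0.
Proof. by apply/eqP => -[] /eqP; rewrite oner_eq0. Qed.

HB.instance Definition _ := GRing.Zmodule_isComNzRing.Build (coordring W)
  coord_mulA coord_mulC coord_mul1 coord_mulDl coord_one_neq0.

End CoordinateRing.

Section Norm.
Variables (K : fieldType) (W : weierstrass K).
Local Notation A := (coordring W).
Local Notation F := (cubic W).
Local Notation T := (trace W).
Implicit Types (f g : A).

Lemma coordM1 f g : (f * g).1 = f.1 * g.1 + f.2 * g.2 * F.
Proof. by []. Qed.
Lemma coordM2 f g : (f * g).2 = f.1 * g.2 + f.2 * g.1 - f.2 * g.2 * T.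
Proof. by []. Qed.
Lemma coordD1 f g : (f + g).1 = f.1 + g.1. Proof. by []. Qed.
Lemma coordD2 f g : (f + g).2 = f.2 + g.2. Proof. by []. Qed.
Lemma coordN1 f : (- f).1 = - f.1. Proof. by []. Qed.
Lemma coordN2 f : (- f).2 = - f.2. Proof. by []. Qed.

Definition coordE := (coordM1, coordM2, coordD1, coordD2, coordN1, coordN2).

Definition cnorm f : {poly K} := f.1 ^+ 2 - f.1 * f.2 * T - f.2 ^+ 2 * F.

Lemma cnormM f g : cnorm (f * g) = cnorm f * cnorm g.
Proof. by rewrite /cnorm !coordE; ring. Qed.

Lemma size_cubic : size F = 4%N.
Proof.
rewrite /cubic -!addrA size_polyDl size_polyXn //.
apply: leq_ltn_trans (size_polyD _ _) _; rewrite gtn_max.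
apply/andP; split; last first.
  apply: leq_ltn_trans (size_polyD _ _) _; rewrite gtn_max.
  rewrite (leq_ltn_trans (size_polyC_leq1 _)) // andbT.
  by rewrite mul_polyC (leq_ltn_trans (size_scale_leq _ _)) // size_polyX.
by rewrite mul_polyC (leq_ltn_trans (size_scale_leq _ _)) // size_polyXn.
Qed.

Lemma size_trace : (size T <= 2)%N.
Proof.
apply: leq_trans (size_polyD _ _) _; rewrite geq_max.
rewrite mul_polyC (leq_trans (size_scale_leq _ _)) ?size_polyX //=.
by apply: leq_trans (size_polyC_leq1 _) _.
Qed.

(* The three terms of the norm have degrees 2 deg p, at most
   deg p + deg q + 1, and 2 deg q + 3: the extreme two never agree by parity. *)
Lemma size_cnorm_ge4 f : f.2 != 0 -> (4 <= size (cnorm f))%N.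
Proof.
case: f => p q /= q0; rewrite /cnorm /=.
have sq : (0 < size q)%N by rewrite size_poly_gt0.
have sF : size (q ^+ 2 * F) = ((size q).*2 + 2)%N.
  rewrite size_mul ?expf_neq0 -?size_poly_gt0 ?size_cubic //.
  by rewrite expr2 size_mul //; case: (size q) sq => [|n] // _; lia.
have sT : (size (p * q * T)%R <= size p + size q)%N.
  apply: leq_trans (size_polyMleq _ _) _.
  have := leq_sub2r 1 (leq_add (size_polyMleq p q) size_trace); rewrite !subn1.
  by move: (size p) (size q) sq => m n ? /leq_trans; apply; lia.
have sP : (size (p ^+ 2)%R <= (size p).*2.-1)%N.
  by rewrite expr2 -addnn; apply: size_polyMleq.
case: (leqP (size p) (size q).+1) => h.
  rewrite addrC size_polyDl size_polyN sF; first by case: (size q) sq => // n _; lia.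
  apply: leq_ltn_trans (size_polyD _ _) _; rewrite gtn_max size_polyN.
  by apply/andP; split; [apply: leq_ltn_trans sP _ | apply: leq_ltn_trans sT _];
    move: (size p) (size q) h sq => m n h sq; lia.
have p0 : p != 0 by rewrite -size_poly_gt0; apply: leq_ltn_trans h.
have {}sP : size (p ^+ 2) = (size p).*2.-1 by rewrite expr2 size_mul // addnn.
rewrite -addrA size_polyDl sP.
  by move: (size p) (size q) h sq => m n h sq; lia.
apply: leq_ltn_trans (size_polyD _ _) _; rewrite gtn_max !size_polyN sF.
apply/andP; split; first apply: leq_ltn_trans sT _;
  by move: (size p) (size q) h sq => m n h sq; lia.
Qed.

Lemma cnorm_eq0 f : cnorm f = 0 -> f = 0.
Proof.
move=> h; have f2 : f.2 = 0.
  apply/eqP/negPn/negP => /size_cnorm_ge4.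
  by rewrite h size_poly0.
move: h; rewrite /cnorm f2 mulr0 mul0r expr0n /= mul0r !subr0 => /eqP.
by rewrite expf_eq0 /= => /eqP f1; apply: coordP.
Qed.

Lemma regular_coord f : f != 0 -> regular f.
Proof.
move=> f0 g fg0; apply: cnorm_eq0.
have /eqP : cnorm f * cnorm g = 0.
  by rewrite -cnormM fg0 /cnorm /=; ring.
by rewrite mulf_eq0 => /orP[/eqP /cnorm_eq0 /eqP|/eqP //]; rewrite (negbTE f0).
Qed.

Definition horner_ringE :=
  (hornerD, hornerN, @hornerM K, hornerC, hornerX, hornerXn).

Definition ceval (x y : K) f : K := f.1.[x] + f.2.[x] * y.

Lemma cevalM x y f g : on_curve W (Affine x y) ->
  ceval x y (f * g) = ceval x y f * ceval x y g.
Proof.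
move=> /= /eqP h; rewrite /ceval !coordE /cubic /trace !horner_ringE.
transitivity (f.1.[x] * g.1.[x] + (f.1.[x] * g.2.[x] + f.2.[x] * g.1.[x]) * y
  + f.2.[x] * g.2.[x] * (x ^+ 3 + a2 W * x ^+ 2 + a4 W * x + a6 W
     - a1 W * x * y - a3 W * y)); first by ring.
by rewrite -h; ring.
Qed.

Definition point_ideal (P : Defs.point K) : set (coordring W) :=
  if P is Affine x y then [set f | ceval x y f = 0] else setT.

Lemma ideal_point_ideal P : on_curve W P -> ideal (point_ideal P).
Proof.
case: P => [|x y] hP; first by split.
split=> /= [|f g hf hg|f g hg].
- by rewrite /ceval /= !horner0 mul0r addr0.
- transitivity (ceval x y f + ceval x y g); last by rewrite hf hg addr0.
  by rewrite /ceval !coordE !hornerD; ring.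
- by rewrite cevalM // hg mulr0.
Qed.

Definition vert_line (x : K) : A := ('X - x%:P, 0).
Definition line (l x y : K) : A := (- (l%:P * ('X - x%:P) + y%:P), 1).

Lemma point_ideal_vert_line x y : point_ideal (Affine x y) (vert_line x).
Proof. by rewrite /= /ceval /= !horner_ringE; ring. Qed.

Lemma point_ideal_line l x y : point_ideal (Affine x y) (line l x y).
Proof. by rewrite /= /ceval /= !horner_ringE; ring. Qed.

(* The line through (x1, y1) of slope l and a point (x, y) on it generate the
   ideal of (x, y) together with X - x. *)
Lemma point_ideal_gen l x1 y1 x f :
  point_ideal (Affine x (l * (x - x1) + y1)) f ->
  exists u v : A, f = vert_line x * u + line l x1 y1 * v.
Proof.
case: f => p q /=; rewrite /ceval /= => h.
pose s := p + q * (l%:P * ('X - x1%:P) + y1%:P).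
have /factor_theorem [u eu] : root s x.
  by apply/eqP; rewrite /s !horner_ringE -h; ring.
have {}eu : p + q * (l%:P * ('X - x1%:P) + y1%:P) = u * ('X - x%:P) by [].
exists (u, 0), (q, 0); apply: coordP; rewrite !coordE /=; last by ring.
by rewrite -[p](addrK (q * (l%:P * ('X - x1%:P) + y1%:P))) eu; ring.
Qed.

Lemma vert_line_neq0 x : vert_line x != 0.
Proof. by apply/eqP => -[] /eqP; rewrite polyXsubC_eq0. Qed.

Lemma line_neq0 l x y : line l x y != 0.
Proof. by apply/eqP => -[] _ /eqP; rewrite oner_eq0. Qed.

End Norm.

(** * The group law *)

Section AdditionLaw.
Variables (K : fieldType) (W : weierstrass K).
Implicit Types (P Q : Defs.point K).

Definition slope_rel (l x1 y1 x2 : K) : Prop :=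
  l * (2 * y1 + l * (x2 - x1) + a1 W * x2 + a3 W)
  = x1 ^+ 2 + x1 * x2 + x2 ^+ 2 + a2 W * (x1 + x2) + a4 W - a1 W * y1.

Lemma on_curve_same_x x y1 y2 :
  on_curve W (Affine x y1) -> on_curve W (Affine x y2) ->
  y2 = y1 \/ y1 = - y2 - a1 W * x - a3 W.
Proof.
move=> /eqP h1 /eqP h2.
have : (y2 - y1) * (y1 - (- y2 - a1 W * x - a3 W)) == 0.
  apply/eqP; rewrite -[RHS](subrr (x ^+ 3 + a2 W * x ^+ 2 + a4 W * x + a6 W)).
  by rewrite -{1}h2 -h1; ring.
by rewrite mulf_eq0 !subr_eq0 => /orP[] /eqP; [left | right].
Qed.

Lemma diff_on_curve x1 y1 x2 y2 :
  on_curve W (Affine x1 y1) -> on_curve W (Affine x2 y2) ->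
  (y2 - y1) * (y1 + y2 + a1 W * x2 + a3 W)
  = (x2 - x1) * (x1 ^+ 2 + x1 * x2 + x2 ^+ 2 + a2 W * (x1 + x2) + a4 W - a1 W * y1).
Proof.
move=> /eqP h1 /eqP h2; apply/eqP; rewrite -subr_eq0; apply/eqP.
transitivity ((y2 ^+ 2 + a1 W * x2 * y2 + a3 W * y2
     - (x2 ^+ 3 + a2 W * x2 ^+ 2 + a4 W * x2 + a6 W))
   - (y1 ^+ 2 + a1 W * x1 * y1 + a3 W * y1
     - (x1 ^+ 3 + a2 W * x1 ^+ 2 + a4 W * x1 + a6 W))); first by ring.
by rewrite h1 h2 !subrr.
Qed.

Lemma raw_add_affine x1 y1 x2 y2 :
  on_curve W (Affine x1 y1) -> on_curve W (Affine x2 y2) ->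
  (raw_add W (Affine x1 y1) (Affine x2 y2) = Infinity /\ x1 = x2 /\
     y1 = - y2 - a1 W * x2 - a3 W) \/
  exists l, [/\ y2 = l * (x2 - x1) + y1, slope_rel l x1 y1 x2,
     x1 = x2 -> y1 = y2 /\ 2 * y1 + a1 W * x1 + a3 W != 0 &
     raw_add W (Affine x1 y1) (Affine x2 y2) = chord W l x1 y1 x2].
Proof.
move=> h1 h2; rewrite /raw_add; case: (eqVneq x1 x2) => [ex|nx] /=; last first.
  right; exists ((y2 - y1) / (x2 - x1)).
  have d0 : x2 - x1 != 0 by rewrite subr_eq0 eq_sym.
  split=> // [|| /eqP]; last by rewrite (negbTE nx).
    by rewrite divfK // subrK.
  rewrite /slope_rel; apply: (mulIf d0).
  rewrite [RHS]mulrC -(diff_on_curve h1 h2); field; exact: d0.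
subst x2; case: eqVneq => [ey|ny]; first by left.
right; exists ((3 * x1 ^+ 2 + 2 * a2 W * x1 + a4 W - a1 W * y1)
                / (2 * y1 + a1 W * x1 + a3 W)).
have [ey|/eqP] := on_curve_same_x h1 h2; last by rewrite (negbTE ny).
subst y2.
have nd : 2 * y1 + a1 W * x1 + a3 W != 0.
  apply: contraNneq ny => d0; rewrite -subr_eq0 -d0; apply/eqP; ring.
split=> //; first by rewrite subrr mulr0 add0r.
by rewrite /slope_rel subrr mulr0 addr0 divfK //; ring.
Qed.

Lemma disc_translate x y : on_curve W (Affine x y) ->
  disc W = disc (Weierstrass (a1 W) (a2 W + 3 * x) (2 * y + a1 W * x + a3 W)
    (3 * x ^+ 2 + 2 * a2 W * x + a4 W - a1 W * y) 0).
Proof.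
move=> /eqP h; have -> : disc W = disc (Weierstrass (a1 W) (a2 W) (a3 W) (a4 W) (a6 W)).
  by [].
have -> : a6 W = y ^+ 2 + a1 W * x * y + a3 W * y - (x ^+ 3 + a2 W * x ^+ 2 + a4 W * x).
  by rewrite h; ring.
by rewrite /disc /=; ring.
Qed.

Lemma disc_singular_at0 (A : comNzRingType) (b1 b2 : A) : disc (Weierstrass b1 b2 0 0 0) = 0.
Proof. by rewrite /disc /=; ring. Qed.

Lemma nonsingular x y : disc W != 0 -> on_curve W (Affine x y) ->
  2 * y + a1 W * x + a3 W = 0 ->
  3 * x ^+ 2 + 2 * a2 W * x + a4 W - a1 W * y != 0.
Proof.
move=> dW hP d0; apply: contraNneq dW => n0.
by rewrite (disc_translate hP) d0 n0 disc_singular_at0.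
Qed.

End AdditionLaw.

Section ClassMap.
Variables (K : fieldType) (W : weierstrass K).
Hypothesis dW : disc W != 0.
Local Notation A := (coordring W).
Local Notation F := (cubic W).
Local Notation T := (trace W).
Local Notation cl := (@point_ideal K W).
Implicit Types (P Q : Defs.point K).

Lemma ideal_const (J : set A) (c : K) : ideal J -> c != 0 ->
  J (c%:P, 0) -> J = principal 1.
Proof.
move=> iJ c0 hc; apply: ideal1 => //; have [_ _ hM] := iJ.
have -> : 1 = (((c^-1)%:P, 0) : A) * ((c%:P, 0) : A) :> A.
  by apply: coordP; rewrite !coordE /= -?polyCM ?mulVf //; ring.
exact: hM.
Qed.

Lemma point_ideal_opp x y : on_curve W (Affine x y) ->
  idmul (cl (Affine x y)) (cl (raw_opp W (Affine x y))) = principal (vert_line W x).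
Proof.
move=> hP; set y' := - y - a1 W * x - a3 W.
pose k : A := ('X^2 + x%:P * 'X + (x ^+ 2)%:P + (a2 W)%:P * ('X + x%:P) + (a4 W)%:P,
               - (a1 W)%:P).
have e6 : a6 W = y ^+ 2 + a1 W * x * y + a3 W * y
                 - (x ^+ 3 + a2 W * x ^+ 2 + a4 W * x).
  by move/eqP: hP => ->; ring.
have ek : line W 0 x y * line W 0 x y' = vert_line W x * k.
  by apply: coordP; rewrite !coordE /line /vert_line /k /y' /cubic /trace /= ?e6; ring.
have gen z f : cl (Affine x z) f -> exists u v : A, f = vert_line W x * u + line W 0 x z * v.
  by move=> hf; apply: point_ideal_gen; rewrite mul0r add0r.
have rt : regular (vert_line W x) by apply/regular_coord/vert_line_neq0.
have [J iJ eJ] : exists2 J, ideal J &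
    idmul (cl (Affine x y)) (cl (Affine x y')) = idmul (principal (vert_line W x)) J.
  apply: sub_principal; first exact: ideal_idmul.
  apply: idmul_sub; first exact: ideal_principal.
  move=> f g /gen [u [v ->]] /gen [u' [v' ->]].
  exists (u * (vert_line W x * u' + line W 0 x y' * v') + line W 0 x y * v * u' + k * v * v').
  transitivity (vert_line W x * u * (vert_line W x * u' + line W 0 x y' * v')
    + vert_line W x * (line W 0 x y * v * u') + line W 0 x y * line W 0 x y' * v * v').
    by ring.
  by rewrite ek; ring.
have memJ f g h : cl (Affine x y) f -> cl (Affine x y') g -> f * g = vert_line W x * h -> J h.
  move=> hf hg e; apply: (idmul_principal_mem rt iJ).
  by rewrite -eJ -e; apply: mem_idmul.
have Jt : J (vert_line W x) by apply: memJ (erefl _); apply: point_ideal_vert_line.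
have Jl : J (line W 0 x y).
  by apply: (memJ (line W 0 x y) (vert_line W x)); rewrite 1?mulrC //;
    [exact: point_ideal_line | exact: point_ideal_vert_line].
have Jl' : J (line W 0 x y').
  by apply: (memJ (vert_line W x) (line W 0 x y')) => //;
    [exact: point_ideal_vert_line | exact: point_ideal_line].
have Jk : J k.
  by apply: (memJ (line W 0 x y) (line W 0 x y')) => //; exact: point_ideal_line.
have [J0 JD JM] := iJ.
suff J1 : J = principal 1 by rewrite /= -/y' eJ J1 principalM mulr1.
have [d0|nd] := eqVneq (2 * y + a1 W * x + a3 W) 0; last first.
  apply: (ideal_const iJ nd).
  have -> : ((2 * y + a1 W * x + a3 W)%:P, 0) = line W 0 x y' + (-1) * line W 0 x y.
    by apply: coordP; rewrite !coordE /line /y' /=; ring.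
  by apply: JD => //; apply: JM.
apply: (ideal_const iJ (nonsingular dW hP d0)).
have -> : ((3 * x ^+ 2 + 2 * a2 W * x + a4 W - a1 W * y)%:P, 0)
  = k + ((- ('X + 2 * x%:P + (a2 W)%:P), 0) : A) * vert_line W x + (((a1 W)%:P, 0) : A) * line W 0 x y.
  by apply: coordP; rewrite !coordE /line /vert_line /k /=; ring.
by apply: (JD); [apply: (JD) => // |]; apply: JM.
Qed.

Lemma line_poly l x1 y1 x2 : on_curve W (Affine x1 y1) -> slope_rel W l x1 y1 x2 ->
  let L := l%:P * ('X - x1%:P) + y1%:P in
  F - T * L - L ^+ 2 =
  ('X - x1%:P) * ('X - x2%:P) * ('X - (l ^+ 2 + a1 W * l - a2 W - x1 - x2)%:P).
Proof.
move=> /eqP h hs L.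
have e4 : a4 W = l * (2 * y1 + l * (x2 - x1) + a1 W * x2 + a3 W)
     - (x1 ^+ 2 + x1 * x2 + x2 ^+ 2 + a2 W * (x1 + x2) - a1 W * y1) by rewrite hs; ring.
have e6 : a6 W = y1 ^+ 2 + a1 W * x1 * y1 + a3 W * y1
                 - (x1 ^+ 3 + a2 W * x1 ^+ 2 + a4 W * x1) by rewrite h; ring.
by rewrite /L /cubic /trace e6 e4; ring.
Qed.

Lemma point_ideal_line_sub l x1 y1 x2 x3 :
  let L := l%:P * ('X - x1%:P) + y1%:P in
  F - T * L - L ^+ 2 = ('X - x1%:P) * ('X - x2%:P) * ('X - x3%:P) ->
  idmul (idmul (cl (Affine x1 y1)) (cl (Affine x2 (l * (x2 - x1) + y1))))
        (cl (Affine x3 (l * (x3 - x1) + y1))) `<=` principal (line W l x1 y1).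
Proof.
move=> L hL.
have ek : vert_line W x1 * vert_line W x2 * vert_line W x3 = line W l x1 y1 * ((T + L, 1) : A).
  apply: coordP; rewrite !coordE /line /vert_line /= -/L; last by ring.
  by rewrite !mulr0 !mul0r !addr0 -hL; ring.
pose I : set A := principal (line W l x1 y1).
have iI : ideal I := ideal_principal _.
have gen x z f : z = l * (x - x1) + y1 -> cl (Affine x z) f ->
    exists u v : A, f = vert_line W x * u + line W l x1 y1 * v.
  by move=> ->; apply: point_ideal_gen.
apply: idmul_sub => // f h hf hh.
move: f hf; apply: (idmul_sub (L := [set f | I (f * h)])).
  have [I0 ID IM] := iI.
  split=> [|f g hf hg|f g hg] /=; first by rewrite mul0r.
    by rewrite mulrDl; apply: ID.
  by rewrite -mulrA; apply: IM.
move=> f g /gen [|u [v ->]]; first by ring.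
move=> /gen [|u' [v' ->]]; first by ring.
move: hh => /gen [|u'' [v'' ->]]; first by ring.
exists (((T + L, 1) : A) * u * u' * u''
  + v * (vert_line W x2 * u' + line W l x1 y1 * v') * (vert_line W x3 * u'' + line W l x1 y1 * v'')
  + vert_line W x1 * u * v' * (vert_line W x3 * u'' + line W l x1 y1 * v'')
  + vert_line W x1 * u * vert_line W x2 * u' * v'').
rewrite [RHS]mulrDr [in RHS]mulrDr [in RHS]mulrDr !mulrA -ek; ring.
Qed.

End ClassMap.

Section ClassMapMorphism.
Variables (K : fieldType) (W : weierstrass K).
Hypothesis dW : disc W != 0.
Local Notation A := (coordring W).
Local Notation F := (cubic W).
Local Notation T := (trace W).
Local Notation cl := (@point_ideal K W).
Implicit Types (P Q : Defs.point K).

Lemma on_line_curve l x1 y1 x2 x3 : on_curve W (Affine x1 y1) ->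
  slope_rel W l x1 y1 x2 -> x3 = l ^+ 2 + a1 W * l - a2 W - x1 - x2 ->
  on_curve W (Affine x3 (l * (x3 - x1) + y1)).
Proof.
move=> h1 hs e3; have := line_poly h1 hs; rewrite -e3.
move=> /(congr1 (fun p => p.[x3])); rewrite /cubic /trace.
rewrite expr2 !horner_ringE subrr mulr0 => e.
by rewrite /= eq_sym -subr_eq0 -e; apply/eqP; ring.
Qed.

(* The product is contained in the ideal of the line, and likewise for the
   opposite points and the conjugate line; the product of the two inclusions is
   an equality, both sides being (X - x1) (X - x2) (X - x3), so each of them is. *)
Lemma point_ideal_collinear l x1 y1 x2 x3 :
  on_curve W (Affine x1 y1) -> on_curve W (Affine x2 (l * (x2 - x1) + y1)) ->
  slope_rel W l x1 y1 x2 -> x3 = l ^+ 2 + a1 W * l - a2 W - x1 - x2 ->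
  idmul (idmul (cl (Affine x1 y1)) (cl (Affine x2 (l * (x2 - x1) + y1))))
        (cl (Affine x3 (l * (x3 - x1) + y1))) = principal (line W l x1 y1).
Proof.
move=> h1 h2 hs e3; have h3 := on_line_curve h1 hs e3.
have hL := line_poly h1 hs; rewrite -e3 in hL.
pose l' := - (a1 W + l); pose y1' := - y1 - a1 W * x1 - a3 W.
have hL' : let L := l'%:P * ('X - x1%:P) + y1'%:P in
    F - T * L - L ^+ 2 = ('X - x1%:P) * ('X - x2%:P) * ('X - x3%:P).
  by rewrite /= -hL /trace /l' /y1'; ring.
have opp x : raw_opp W (Affine x (l * (x - x1) + y1)) = Affine x (l' * (x - x1) + y1').
  by congr Affine; rewrite /l' /y1'; ring.
have opp1 : raw_opp W (Affine x1 y1) = Affine x1 y1' by [].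
have e := point_ideal_opp dW h1; rewrite opp1 in e.
have := point_ideal_opp dW h2; have := point_ideal_opp dW h3.
rewrite !opp => e3' e2'.
have [J iJ eJ] := sub_principal (ideal_idmul _ _) (point_ideal_line_sub hL).
have [J' iJ' eJ'] := sub_principal (ideal_idmul _ _) (point_ideal_line_sub hL').
have ek : vert_line W x1 * vert_line W x2 * vert_line W x3 =
    line W l x1 y1 * line W l' x1 y1'.
  apply: coordP; rewrite !coordE /line /vert_line /=; last first.
    by rewrite /l' /y1' /trace; ring.
  by rewrite !mulr0 !mul0r !addr0 -hL /l' /y1' /trace; ring.
have e1 : principal (line W l x1 y1 * line W l' x1 y1') =
    idmul (idmul (principal (line W l x1 y1)) J) (idmul (principal (line W l' x1 y1')) J').
  rewrite -ek -!principalM -e -e2' -e3' -eJ -eJ' (idmulACA (cl (Affine x1 y1))).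
  exact: idmulACA.
have JJ' : idmul J J' = principal 1.
  apply: (@idmulI _ (line W l x1 y1 * line W l' x1 y1')).
  - by apply: regularM; apply/regular_coord/line_neq0.
  - exact: ideal_idmul.
  - exact: ideal_principal.
  rewrite principalM mulr1 -principalM -idmulACA -e1 principalM; exact: erefl.
suff J1 : J = principal 1 by rewrite eJ J1 principalM mulr1.
apply: ideal1 => //; have : idmul J J' 1 by rewrite JJ'; exists 1; rewrite mulr1.
apply: idmul_sub => // a b ha _; rewrite mulrC.
by have [_ _ JM] := iJ; apply: JM.
Qed.

Lemma ideq_principal a b (I J : set A) : a != 0 -> b != 0 ->
  idmul (principal a) I = idmul (principal b) J -> ideq I J.
Proof. by move=> a0 b0 e; exists a, b; split=> //; apply: regular_coord. Qed.

Lemma point_ideal_add P Q : on_curve W P -> on_curve W Q ->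
  ideq (cl (raw_add W P Q)) (idmul (cl P) (cl Q)).
Proof.
case: P => [|x1 y1] hP hQ.
  by rewrite /= setT_principal idmul1; [exact: ideq_refl | exact: ideal_point_ideal].
case: Q hQ => [|x2 y2] hQ.
  rewrite (_ : raw_add _ _ _ = Affine x1 y1) //= setT_principal idmulC idmul1.
    exact: ideq_refl.
  exact: (ideal_point_ideal hP).
have [[-> [ex ey]]|[l [ey hs _ ->]]] := raw_add_affine hP hQ.
  rewrite idmulC ex in hP *; rewrite (_ : Affine x2 y1 = raw_opp W (Affine x2 y2)) ?ey //.
  rewrite point_ideal_opp // /= setT_principal.
  apply: (@ideq_principal (vert_line W x2) 1); rewrite ?vert_line_neq0 ?oner_eq0 //.
  by rewrite !principalM mulrC.
rewrite ey in hQ *; rewrite /chord; set x3 := (l ^+ 2 + _ - _ - _ - _).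
have h3 := on_line_curve hP hs (erefl x3).
have e := point_ideal_collinear hP hQ hs (erefl x3).
have e3 := point_ideal_opp dW h3.
apply: (@ideq_principal (line W l x1 y1) (vert_line W x3));
  rewrite ?line_neq0 ?vert_line_neq0 //.
by rewrite -e -e3 -idmulA [RHS]idmulC.
Qed.

Lemma coord_dvd1 (p u v : {poly K}) (g : A) : (u, v) = ((p, 0) : A) * g -> p %| v.
Proof.
move=> /(congr1 snd) /= ->; rewrite !mul0r addr0 subr0; exact: dvdp_mulr.
Qed.

Lemma point_ideal_not_principal x y (c : A) :
  cl (Affine x y) = principal c -> False.
Proof.
case: c => p q e.
have [f ef] : principal ((p, q) : A) (vert_line W x).
  by rewrite -e; exact: point_ideal_vert_line.
have [g eg] : principal ((p, q) : A) (line W 0 x y).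
  by rewrite -e; exact: point_ideal_line.
have q0 : q = 0.
  apply/eqP/negPn/negP => q0; have := @size_cnorm_ge4 _ W (p, q) q0.
  have h : cnorm (vert_line W x) = ('X - x%:P) ^+ 2 by rewrite /cnorm /=; ring.
  have : cnorm ((p, q) : A) %| ('X - x%:P) ^+ 2 by rewrite -h ef cnormM dvdp_mulr.
  move=> /(dvdp_leq (expf_neq0 2 (negbT (polyXsubC_eq0 x)))).
  by rewrite size_exp_XsubC => h1 h2; have := leq_trans h2 h1.
subst q; have := coord_dvd1 eg; rewrite dvdp1 => /eqP p1.
have [k k0 ek] : exists2 k, k != 0 & p = k%:P.
  by have /size_poly1P [k k0 ek] := introT eqP p1; exists k.
have : cl (Affine x y) ((p, 0) : A) by rewrite e; exists 1; rewrite mulr1.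
rewrite /= /ceval /= ek hornerC horner0 mul0r addr0 => /eqP.
by rewrite (negbTE k0).
Qed.

Lemma point_ideal_mul_principal x1 y1 x2 y2 (c : A) :
  on_curve W (Affine x1 y1) ->
  idmul (cl (Affine x1 y1)) (cl (Affine x2 y2)) = principal c ->
  Affine x2 y2 = raw_opp W (Affine x1 y1).
Proof.
case: c => p q h1 e.
have mem f g : cl (Affine x1 y1) f -> cl (Affine x2 y2) g -> exists h, f * g = ((p, q) : A) * h.
  by move=> hf hg; have : principal ((p, q) : A) (f * g) by rewrite -e; exact: mem_idmul.
have v1 := point_ideal_vert_line W x1 y1; have v2 := point_ideal_vert_line W x2 y2.
have l1 := point_ideal_line W 0 x1 y1; have l2 := point_ideal_line W 0 x2 y2.
have q0 : q = 0.
  have [h eh] := mem _ _ v1 v2.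
  apply/eqP/negPn/negP => q0; have := @size_cnorm_ge4 _ W (p, q) q0.
  have := congr1 (@cnorm K W) eh; rewrite !cnormM.
  have nv x : cnorm (vert_line W x) = ('X - x%:P) ^+ 2 by rewrite /cnorm /=; ring.
  rewrite !nv => en.
  have : size (cnorm ((p, q) : A) * cnorm h) = 5%N.
    by rewrite -en size_mul ?size_exp_XsubC // expf_neq0 // polyXsubC_eq0.
  have [->|h0] := eqVneq (cnorm h) 0; first by rewrite mulr0 size_poly0.
  have [->|n0] := eqVneq (cnorm ((p, q) : A)) 0; first by rewrite mul0r size_poly0.
  rewrite size_mul //; case: h eh {en} h0 => u v eh h0 s5 s4.
  have v0 : v = 0.
    apply/eqP/negPn/negP => v0; have := @size_cnorm_ge4 _ W (u, v) v0.
    by move: s5 s4; move: (size _) (size _) => m n; lia.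
  move: eh => /(congr1 snd); rewrite !coordM2 /= v0 !(mulr0, mul0r, subr0, oppr0, addr0, add0r).
  move=> /esym /eqP; rewrite mulf_eq0 (negbTE q0) /= => /eqP u0; move: h0.
  by rewrite u0 v0 /cnorm /= !(mul0r, subr0, expr0n) eqxx.
subst q.
have d1 : p %| 'X - x1%:P.
  have [h eh] := mem _ _ v1 l2;
  rewrite (_ : _ * _ = ((vert_line W x1).1 * (line W 0 x2 y2).1, 'X - x1%:P) :> A) in eh.
    exact: (coord_dvd1 eh).
  by apply: coordP; rewrite !coordE /=; ring.
have d2 : p %| 'X - x2%:P.
  have [h eh] := mem _ _ l1 v2;
  rewrite (_ : _ * _ = ((vert_line W x2).1 * (line W 0 x1 y1).1, 'X - x2%:P) :> A) in eh.
    exact: (coord_dvd1 eh).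
  by apply: coordP; rewrite !coordE /=; ring.
have d3 : p %| T + y1%:P + y2%:P.
  have [h eh] := mem _ _ l1 l2;
  rewrite (_ : _ * _ = ((line W 0 x1 y1 * line W 0 x2 y2).1, - (T + y1%:P + y2%:P)) :> A) in eh.
    by have := coord_dvd1 eh; rewrite dvdpNr.
  by apply: coordP; rewrite !coordE /=; ring.
have r1 : root p x1.
  have : cl (Affine x1 y1) ((p, 0) : A).
    have : idmul (cl (Affine x1 y1)) (cl (Affine x2 y2)) ((p, 0) : A).
      by rewrite e; exists 1; rewrite mulr1.
    apply: idmul_sub; first exact: ideal_point_ideal.
    move=> a b ha _; rewrite mulrC.
    by have [_ _ hM] := ideal_point_ideal h1; apply: hM.
  by rewrite /= /ceval /= horner0 mul0r addr0 => /eqP.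
have := root_dvdp d2 r1; rewrite root_XsubC => /eqP ex.
have := root_dvdp d3 r1; rewrite /root /trace !horner_ringE => /eqP ey.
rewrite /=; congr Affine; first by [].
by rewrite -[y2]subr0 -ey; ring.
Qed.

Lemma raw_oppK P : raw_opp W (raw_opp W P) = P.
Proof. by case: P => //= x y; congr Affine; ring. Qed.

Lemma point_ideal_inj P Q : on_curve W P -> on_curve W Q -> ideq (cl P) (cl Q) -> P = Q.
Proof.
have notO x y : ideq (cl Infinity) (cl (Affine x y)) -> on_curve W (Affine x y) -> False.
  move=> [a [b [ra rb e]]] hP.
  have iP := ideal_point_ideal hP.
  have [c hc ec] : [set f | exists2 g, cl (Affine x y) g & f = b * g] a.
    by rewrite -idmul_principal // -e /= setT_principal principalM mulr1; exists 1; rewrite mulr1.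
  apply: (@point_ideal_not_principal x y c); apply: (idmulI rb) => //.
    exact: ideal_principal.
  by rewrite -e principalM -ec /= setT_principal principalM mulr1.
case: P => [|x1 y1]; case: Q => [|x2 y2] // hP hQ.
- by move=> /notO h; case: (h hQ).
- by move=> /ideq_sym /notO h; case: (h hP).
move=> [a [b [ra rb e]]].
have e' := point_ideal_opp dW hQ.
set I := idmul (cl (Affine x1 y1)) (cl (raw_opp W (Affine x2 y2))).
have eI : idmul (principal a) I = principal (b * vert_line W x2).
  by rewrite /I idmulA e -idmulA e' principalM.
have [c hc ec] : [set f | exists2 g, I g & f = a * g] (b * vert_line W x2).
  by rewrite -idmul_principal ?eI; [exists 1; rewrite mulr1 | exact: ideal_idmul].
have : I = principal c.
  apply: (idmulI ra); [exact: ideal_idmul | exact: ideal_principal |].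
  by rewrite eI ec principalM.
move=> /(point_ideal_mul_principal hP) e12.
by rewrite -[LHS]raw_oppK -e12; apply: (raw_oppK (Affine x2 y2)).
Qed.

End ClassMapMorphism.

Section GroupAxioms.
Variables (K : fieldType) (W : weierstrass K).
Hypothesis dW : disc W != 0.
Implicit Types (P Q S : ecpoint W).

Lemma ecaddC : commutative (@ecadd K W).
Proof.
move=> [P hP] [Q hQ]; apply: val_inj => /=.
apply: (point_ideal_inj dW); rewrite ?on_curve_add //.
apply: ideq_trans (point_ideal_add dW hP hQ) _; rewrite idmulC.
exact/ideq_sym/point_ideal_add.
Qed.

Lemma ecaddA : associative (@ecadd K W).
Proof.
move=> [P hP] [Q hQ] [S hS]; apply: val_inj => /=.
have hPQ := on_curve_add hP hQ; have hQS := on_curve_add hQ hS.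
apply: (point_ideal_inj dW); rewrite ?on_curve_add //.
apply: ideq_trans (point_ideal_add dW hP hQS) _.
apply: ideq_trans (ideq_mull _ (point_ideal_add dW hQ hS)) _.
rewrite idmulA; apply: ideq_sym.
apply: ideq_trans (point_ideal_add dW hPQ hS) _; rewrite ![idmul _ (point_ideal S)]idmulC.
exact: ideq_mull (point_ideal_add dW hP hQ).
Qed.

Lemma ecadd0 : left_id (ec0 W) (@ecadd K W).
Proof. by move=> P; apply: val_inj. Qed.

Lemma ecaddN : left_inverse (ec0 W) (@ecopp K W) (@ecadd K W).
Proof.
move=> [[|x y] hP]; apply: val_inj => //=; rewrite eqxx /=.
by rewrite eqxx.
Qed.

End GroupAxioms.

(** * Reduction modulo p *)

Section LocalRing.
Variables (p : nat) (pr : prime p).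

(* The localization of Z at p and its maximal ideal; the primality proof is a
   parameter so that the closure instances below can be attached to them. *)
Definition pint of prime p : {pred rat} := fun r => ~~ (p %| `|denq r|)%N.
Definition pmax of prime p : {pred rat} := fun r => (p %| `|numq r|)%N.
Local Notation O := (pint pr).
Local Notation m := (pmax pr).

Lemma fracP (r : rat) : exists a b : int,
  [/\ r = a%:~R / b%:~R, b != 0, coprime `|a| `|b|,
    (r \in O) = ~~ (p %| `|b|)%N & (r \in m) = (p %| `|a|)%N].
Proof.
by exists (numq r), (denq r); split=> //; rewrite ?divq_num_den ?denq_neq0 ?coprime_num_den.
Qed.

Lemma frac_cross (r : rat) (a b : int) : b != 0 -> r = a%:~R / b%:~R ->
  (numq r * b = a * denq r)%R.
Proof.
move=> b0 e; have d0 := denq_neq0 r; apply: (@intr_inj rat).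
rewrite !rmorphM /=.
have : (numq r)%:~R / (denq r)%:~R = a%:~R / b%:~R :> rat by rewrite divq_num_den.
move/eqP; rewrite eqr_div ?intr_eq0 // => /eqP //.
Qed.

Lemma pint_frac (a b : int) : ~~ (p %| `|b|)%N -> a%:~R / b%:~R \in O.
Proof.
move=> pb; have b0 : b != 0 by apply: contraNneq pb => ->.
have := congr1 absz (frac_cross b0 (erefl (a%:~R / b%:~R))); rewrite !abszM => e.
apply: contra pb => pd.
have : (p %| `|numq (a%:~R / b%:~R)| * `|b|)%N by rewrite e dvdn_mull.
rewrite Euclid_dvdM // => /orP[pn|//].
have := coprime_num_den (a%:~R / b%:~R); rewrite /coprime => /eqP g1.
have : (p %| 1)%N by rewrite -g1 dvdn_gcd pn.
by rewrite dvdn1; case: eqP pr => // ->.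
Qed.

Lemma pmax_frac (a b : int) : ~~ (p %| `|b|)%N -> (p %| `|a|)%N ->
  a%:~R / b%:~R \in m.
Proof.
move=> pb pa; have b0 : b != 0 by apply: contraNneq pb => ->.
have := congr1 absz (frac_cross b0 (erefl (a%:~R / b%:~R))); rewrite !abszM => e.
have : (p %| `|numq (a%:~R / b%:~R)| * `|b|)%N by rewrite e dvdn_mulr.
by rewrite Euclid_dvdM // (negbTE pb) orbF.
Qed.

Lemma pmax_pint r : r \in m -> r \in O.
Proof.
have [a [b [_ _ + -> ->]]] := fracP r; rewrite /coprime => /eqP g1 pa.
apply/negP => pb; have : (p %| 1)%N by rewrite -g1 dvdn_gcd pa.
by rewrite dvdn1; case: eqP pr => // ->.
Qed.

Lemma pint_subring : subring_closed O.
Proof.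
split=> [|r1 r2|r1 r2].
- by rewrite -[1]/(1%:~R) -[1%:~R]divr1; apply: (@pint_frac 1 1); rewrite dvdn1; case: eqP pr => // ->.
- have [a1 [b1 [-> b10 _ -> _]]] := fracP r1; have [a2 [b2 [-> b20 _ -> _]]] := fracP r2.
  move=> p1 p2; rewrite -mulNr addf_div ?intr_eq0 // -rmorphN -!rmorphM -rmorphD.
  by apply: pint_frac; rewrite abszM Euclid_dvdM // negb_or p1.
- have [a1 [b1 [-> b10 _ -> _]]] := fracP r1; have [a2 [b2 [-> b20 _ -> _]]] := fracP r2.
  move=> p1 p2; rewrite mulf_div -!rmorphM.
  by apply: pint_frac; rewrite abszM Euclid_dvdM // negb_or p1.
Qed.
HB.instance Definition _ := GRing.isSubringClosed.Build rat O pint_subring.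

Lemma pmax_zmod : zmod_closed m.
Proof.
split=> [|r1 r2]; first exact: (dvdn0 p).
move=> m1 m2; have := pmax_pint m2; have := pmax_pint m1; move: m1 m2.
have [a1 [b1 [-> b10 _ -> ->]]] := fracP r1; have [a2 [b2 [-> b20 _ -> ->]]] := fracP r2.
move=> pa1 pa2 p1 p2; rewrite -mulNr addf_div ?intr_eq0 // -rmorphN -!rmorphM -rmorphD.
apply: pmax_frac; first by rewrite abszM Euclid_dvdM // negb_or p1.
have d1 : (p%:Z %| a1 * b2)%Z by rewrite dvdz_mulr.
have d2 : (p%:Z %| - a2 * b1)%Z by rewrite dvdz_mulr // rpredN.
exact: (rpredD d1 d2).
Qed.
HB.instance Definition _ := GRing.isZmodClosed.Build rat m pmax_zmod.

Lemma pmaxMl r1 r2 : r1 \in O -> r2 \in m -> r1 * r2 \in m.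
Proof.
move=> h1 m2; have := pmax_pint m2; move: h1 m2.
have [a1 [b1 [-> b10 _ -> _]]] := fracP r1; have [a2 [b2 [-> b20 _ -> ->]]] := fracP r2.
move=> p1 pa2 p2; rewrite mulf_div -!rmorphM.
apply: pmax_frac; first by rewrite abszM Euclid_dvdM // negb_or p1.
by rewrite abszM dvdn_mull.
Qed.

Lemma pmaxMr r1 r2 : r1 \in m -> r2 \in O -> r1 * r2 \in m.
Proof. by move=> h1 h2; rewrite mulrC pmaxMl. Qed.

Lemma pmax1 : 1 \notin m.
Proof.
apply/negP => h; have : (p %| 1)%N by exact: h.
by rewrite dvdn1; case: eqP pr => // ->.
Qed.

Lemma pintV r : r \in O -> r \notin m -> r^-1 \in O.
Proof.
have [a [b [-> b0 _ -> ->]]] := fracP r => pb pa.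
by rewrite invf_div pint_frac.
Qed.

Lemma pmaxV r : r \notin O -> r^-1 \in m.
Proof.
have [a [b [-> b0 cop -> _]]] := fracP r; rewrite negbK => pb.
rewrite invf_div pmax_frac //; apply/negP => pa.
move: cop; rewrite /coprime => /eqP g1; have : (p %| 1)%N by rewrite -g1 dvdn_gcd pa.
by rewrite dvdn1; case: eqP pr => // ->.
Qed.

Lemma pint_int (a : int) : a%:~R \in O. Proof. exact: rpred_int. Qed.

Lemma pmax_int (a : int) : (a%:~R \in m) = (p %| `|a|)%N.
Proof. by rewrite /in_mem /= /pmax numq_int. Qed.

Lemma ratr_Fp_eq r1 r2 : r1 \in O -> r2 \in O ->
  (ratr r1 == ratr r2 :> 'F_p) = (r1 - r2 \in m).
Proof.
move=> h1 h2.
have intr0 (z : int) : (z%:~R == 0 :> 'F_p) = (p %| `|z|)%N.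
  have F0 (n : nat) : (n%:R == 0 :> 'F_p) = (p %| n)%N.
    by rewrite -(dvdn_pcharf (pchar_Fp pr)).
  case: z => n; first by rewrite -F0.
  by rewrite NegzE mulrNz oppr_eq0 abszN -F0.
have d1 : (denq r1)%:~R != 0 :> 'F_p by rewrite intr0.
have d2 : (denq r2)%:~R != 0 :> 'F_p by rewrite intr0.
have e : r1 - r2 = (numq r1 * denq r2 - numq r2 * denq r1)%:~R / (denq r1 * denq r2)%:~R.
  rewrite -{1}(divq_num_den r1) -{1}(divq_num_den r2) -mulNr addf_div ?intr_eq0 ?denq_neq0 //.
  by rewrite !rmorphB !rmorphM /= mulNr.
have e2 : (numq r1 * denq r2 - numq r2 * denq r1)%:~R = (r1 - r2) * (denq r1 * denq r2)%:~R.
  by rewrite e divfK // intr_eq0 mulf_neq0 ?denq_neq0.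
rewrite /ratr eqr_div // -subr_eq0 -!rmorphM -rmorphB intr0 -pmax_int e2.
apply/idP/idP => [hm|hm]; last by rewrite pmaxMr ?pint_int.
have dO : (denq r1 * denq r2)%:~R \notin m.
  by rewrite pmax_int abszM Euclid_dvdM // negb_or; apply/andP.
rewrite -[r1 - r2](@mulfK _ (denq r1 * denq r2)%:~R); last first.
  by rewrite intr_eq0 mulf_neq0 ?denq_neq0.
by rewrite pmaxMr // pintV // pint_int.
Qed.

End LocalRing.

Ltac known := match goal with
  H : is_true (?e \in ?S) |- is_true (?e \in ?S) => exact: H end.

Ltac mem_O := first [known | lazymatch goal with
  | |- is_true (_ + _ \in _) => apply: rpredD; mem_O
  | |- is_true (- _ \in _) => rewrite rpredN; mem_O
  | |- is_true (_ * _ \in _) => apply: rpredM; mem_O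
  | |- is_true (_ ^+ _ \in _) => apply: rpredX; mem_O
  | |- is_true (1 \in _) => exact: rpred1
  | |- is_true (_%:R \in _) => exact: rpred_nat
  | |- _ => apply: pmax_pint; known
  end].

Ltac mem_m := first [known | lazymatch goal with
  | |- is_true (_ + _ \in _) => apply: rpredD; mem_m
  | |- is_true (- _ \in _) => rewrite rpredN; mem_m
  | |- is_true (_ * _ \in _) =>
      first [apply: pmaxMl; [mem_O | mem_m] | apply: pmaxMr; [mem_m | mem_O]]
  end].

Lemma tangent_identity (F : fieldType) (n d D x y : F) :
  y != 0 -> D != 0 -> d != 0 ->
  n / y ^+ 2 / D + (y^-1 - n / y ^+ 2 / D * (x / y)) * (n / d)
  = n * (d * y + D * y ^+ 2 - x * n) / (y ^+ 3 * D * d).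
Proof. by move=> y0 D0 d0; field; rewrite y0 D0 d0. Qed.

Section KernelOfReduction.
Variables (p : nat) (pr : prime p) (W : weierstrass rat).
Local Notation O := (pint pr).
Local Notation m := (pmax pr).
Hypotheses (O1 : a1 W \in O) (O2 : a2 W \in O) (O3 : a3 W \in O) (O4 : a4 W \in O)
  (O6 : a6 W \in O) (good : disc W \notin m).

Definition in_kernel (P : Defs.point rat) : bool :=
  if P is Affine x _ then x \notin O else true.

Lemma integral_y x y : on_curve W (Affine x y) -> x \in O -> y \in O.
Proof.
move=> /eqP h hx; apply: contraT => hy.
have y0 : y != 0 by apply: contraNneq hy => ->; exact: rpred0.
have hV := pmaxV hy; have hVO := pmax_pint hV.
rewrite -(negbTE (pmax1 pr)).
rewrite (_ : 1 = y^-1 * (y^-1 * (x ^+ 3 + a2 W * x ^+ 2 + a4 W * x + a6 W)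
   - (a1 W * x + a3 W))); first by mem_m.
by rewrite -h; field.
Qed.

Lemma singular_mod x y : on_curve W (Affine x y) -> x \in O -> y \in O ->
  2 * y + a1 W * x + a3 W \in m ->
  3 * x ^+ 2 + 2 * a2 W * x + a4 W - a1 W * y \notin m.
Proof.
move=> h hx hy hd; apply: contra good => hn.
rewrite (disc_translate h); move: hd hn.
set d := (2 * y + _ + _); set n := (3 * x ^+ 2 + _ + _ - _) => hd hn.
have hdO := pmax_pint hd; have hnO := pmax_pint hn.
have O2' : a2 W + 3 * x \in O by mem_O.
rewrite /disc /=; move: (a2 W + 3 * x) O2' => A O2'.
have m4 : 2 * n + a1 W * d \in m by mem_m.
have O4' := pmax_pint m4.
have m6 : d ^+ 2 + 4 * 0 \in m by rewrite mulr0 addr0 expr2; mem_m.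
have O6' := pmax_pint m6.
have m8 : a1 W ^+ 2 * 0 + 4 * A * 0 - a1 W * d * n + A * d ^+ 2 - n ^+ 2 \in m.
  by rewrite !mulr0 !add0r !expr2; mem_m.
move: (2 * n + _) (d ^+ 2 + _) (_ - n ^+ 2) m4 O4' m6 O6' m8 => b4 b6 b8 *.
by rewrite (exprS b4) (expr2 b6); mem_m.
Qed.

Lemma chord_kernel l x1 y1 x2 : x1 \in O -> x2 \in O ->
  in_kernel (chord W l x1 y1 x2) = (l \notin O).
Proof.
move=> h1 h2; rewrite /=; congr negb; apply/idP/idP => [h|h]; last by mem_O.
apply: contraT => hl.
have l0 : l != 0 by apply: contraNneq hl => ->; exact: rpred0.
have hV := pmaxV hl; have hVO := pmax_pint hV.
rewrite -(negbTE (pmax1 pr)) (_ : 1 = l^-1 * (l^-1 * (l ^+ 2 + a1 W * l - a2 W - x1 - x2 + a2 W + x1 + x2)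
   - a1 W)); last by field.
by mem_m.
Qed.

Lemma add_integral x1 y1 x2 y2 :
  on_curve W (Affine x1 y1) -> on_curve W (Affine x2 y2) -> x1 \in O -> x2 \in O ->
  in_kernel (raw_add W (Affine x1 y1) (Affine x2 y2)) =
  (x1 - x2 \in m) && (y1 + y2 + a1 W * x2 + a3 W \in m).
Proof.
move=> h1 h2 i1 i2; have j1 := integral_y h1 i1; have j2 := integral_y h2 i2.
have [[-> [ex ey]]|[l [ey hs _ ->]]] := raw_add_affine h1 h2.
  rewrite ex subrr rpred0 ey /=; apply/esym.
  by rewrite (_ : _ + _ = 0) ?rpred0 //; ring.
rewrite chord_kernel //.
have iN : x1 ^+ 2 + x1 * x2 + x2 ^+ 2 + a2 W * (x1 + x2) + a4 W - a1 W * y1 \in O by mem_O.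
have hs' : l * (y1 + y2 + a1 W * x2 + a3 W)
  = x1 ^+ 2 + x1 * x2 + x2 ^+ 2 + a2 W * (x1 + x2) + a4 W - a1 W * y1.
  by rewrite -hs ey; ring.
have iD : y1 + y2 + a1 W * x2 + a3 W \in O by mem_O.
have iX : x1 - x2 \in O by mem_O.
apply/idP/idP => [hl|/andP[hx hD]].
  apply/andP; split; apply: contraNT hl => hn.
    have x0 : x1 - x2 != 0 by apply: contraNneq hn => ->; exact: rpred0.
    have -> : l = (y1 - y2) * (x1 - x2)^-1 by rewrite ey; field.
    by apply: rpredM; [mem_O | exact: pintV].
  have D0 : y1 + y2 + a1 W * x2 + a3 W != 0 by apply: contraNneq hn => ->; exact: rpred0.
  by rewrite -[l](mulfK D0) hs'; apply: rpredM => //; apply: pintV.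
apply/negP => hl.
have hy : y1 - y2 \in m.
  by rewrite (_ : _ - _ = l * (x1 - x2)) ?ey; [mem_m | ring].
have := singular_mod h1 i1 j1; move/(_ _)/negP; apply.
  rewrite (_ : 2 * y1 + _ + _ = (y1 + y2 + a1 W * x2 + a3 W) + (y1 - y2) + a1 W * (x1 - x2)).
    by mem_m.
  by ring.
rewrite (_ : 3 * _ + _ + _ - _ = l * (y1 + y2 + a1 W * x2 + a3 W)
    + (2 * x1 + x2 + a2 W) * (x1 - x2)); first by mem_m.
by rewrite hs'; ring.
Qed.

Lemma kernel_inv_coords x y : on_curve W (Affine x y) -> x \notin O ->
  [/\ y != 0, x / y \in m & y^-1 \in m].
Proof.
move=> /eqP h hx.
have x0 : x != 0 by apply: contraNneq hx => ->; exact: rpred0.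
have mu := pmaxV hx; have iu := pmax_pint mu.
have hq : y / x \notin O.
  apply/negP => hq; move: (pmax1 pr).
  rewrite (_ : 1 = x^-1 * ((y / x) ^+ 2 + a1 W * (y / x) + a3 W * (y / x) * x^-1
     - a2 W - a4 W * x^-1 - a6 W * x^-1 ^+ 2)); first by move/negP; apply; mem_m.
  apply: (@mulfI _ (x ^+ 3)); first by rewrite expf_neq0.
  transitivity (y ^+ 2 + a1 W * x * y + a3 W * y - a2 W * x ^+ 2 - a4 W * x - a6 W).
    by rewrite h; ring.
  by field.
have y0 : y != 0 by apply: contraNneq hq => ->; rewrite mul0r rpred0.
have mz : x / y \in m by have := pmaxV hq; rewrite invf_div.
split=> //; rewrite (_ : y^-1 = x^-1 * (x / y)); first by apply: pmaxMl.
by rewrite mulKf.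
Qed.

(* In the coordinates z = x / y and w = 1 / y at infinity, the line joining two
   points of the kernel is w = al z + be with al and be in the maximal ideal;
   in affine coordinates it is al x + be y = 1, and has no integral point. *)
Lemma kernel_line l x1 y1 x2 y2 : on_curve W (Affine x1 y1) ->
  on_curve W (Affine x2 y2) -> x1 \notin O -> x2 \notin O ->
  y2 = l * (x2 - x1) + y1 -> slope_rel W l x1 y1 x2 ->
  (x1 = x2 -> y1 = y2 /\ 2 * y1 + a1 W * x1 + a3 W != 0) ->
  exists al be, [/\ al \in m, be \in m, al * x1 + be * y1 = 1 & al + be * l = 0].
Proof.
move=> h1 h2 k1 k2 ey hs hd.
have [y10 mz1 mw1] := kernel_inv_coords h1 k1.
have [y20 mz2 mw2] := kernel_inv_coords h2 k2.
have iz1 := pmax_pint mz1; have iz2 := pmax_pint mz2.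
have iw1 := pmax_pint mw1; have iw2 := pmax_pint mw2.
move: h1 h2 => /eqP h1 /eqP h2.
pose D (z1 w1 w2 : rat) := 1 + a1 W * z1 + a3 W * (w1 + w2) - a2 W * (z1 * z1) - a4 W * z1 * (w1 + w2)
  - a6 W * (w1 * w1 + w1 * w2 + w2 * w2).
pose N (z1 z2 w2 : rat) := z1 * z1 + z1 * z2 + z2 * z2 + a2 W * w2 * (z1 + z2) + a4 W * (w2 * w2) - a1 W * w2.
have mD1 : D (x1 / y1) y1^-1 y2^-1 - 1 \in m.
  by rewrite /D -!addrA addrC !addrA subrK; mem_m.
have D1 : D (x1 / y1) y1^-1 y2^-1 \notin m.
  by apply: contra (pmax1 pr) => mD; rewrite -(subKr (D (x1 / y1) y1^-1 y2^-1) 1); mem_m.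
have D0 : D (x1 / y1) y1^-1 y2^-1 != 0 by apply: contraNneq D1 => ->; exact: rpred0.
have iD : D (x1 / y1) y1^-1 y2^-1 \in O.
  rewrite -(subrK 1 (D _ _ _)); apply: rpredD; [exact: pmax_pint | exact: rpred1].
have mN : N (x1 / y1) (x2 / y2) y2^-1 \in m by rewrite /N; mem_m.
have iDV := pintV iD D1.
pose al := N (x1 / y1) (x2 / y2) y2^-1 * (D (x1 / y1) y1^-1 y2^-1)^-1.
have mal : al \in m by exact: pmaxMr.
exists al, (y1^-1 - al * (x1 / y1)); split=> //; first by have ial := pmax_pint mal; mem_m.
  by field.
have [ex|nx] := eqVneq x1 x2.
  subst x2; have [ey2 d0] := hd erefl; clear ey; subst y2.
  set d := 2 * y1 + a1 W * x1 + a3 W in d0.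
  pose n := 3 * x1 ^+ 2 + 2 * a2 W * x1 + a4 W - a1 W * y1.
  have el : l = n / d.
    apply: (mulIf d0); rewrite divfK //; move: hs.
    by rewrite /slope_rel /n /d subrr mulr0 addr0 => ->; ring.
  have eN : N (x1 / y1) (x1 / y1) y1^-1 = n / y1 ^+ 2 by rewrite /N /n; field.
  have key : d * y1 + D (x1 / y1) y1^-1 y1^-1 * y1 ^+ 2 - x1 * n = 0.
    transitivity (3 * (y1 ^+ 2 + a1 W * x1 * y1 + a3 W * y1)
      - 3 * (x1 ^+ 3 + a2 W * x1 ^+ 2 + a4 W * x1 + a6 W)).
      by rewrite /d /D /n; field.
    by rewrite h1; ring.
  rewrite /al eN el; move: (D _ _ _) D0 key => Dv D0 key.
  by rewrite tangent_identity // key mulr0 mul0r.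
have curve_zw (x y : rat) : y != 0 ->
    y ^+ 2 + a1 W * x * y + a3 W * y = x ^+ 3 + a2 W * x ^+ 2 + a4 W * x + a6 W ->
    y^-1 + a1 W * (x / y) * y^-1 + a3 W * y^-1 ^+ 2 - ((x / y) ^+ 3 + a2 W * (x / y) ^+ 2 * y^-1
      + a4 W * (x / y) * y^-1 ^+ 2 + a6 W * y^-1 ^+ 3) = 0.
  move=> y0 h; transitivity ((y ^+ 2 + a1 W * x * y + a3 W * y
      - (x ^+ 3 + a2 W * x ^+ 2 + a4 W * x + a6 W)) / y ^+ 3); first by field.
  by rewrite h subrr mul0r.
have c1 := curve_zw _ _ y10 h1; have c2 := curve_zw _ _ y20 h2.
have e21 : al * (x1 / y1 - x2 / y2) = y1^-1 - y2^-1.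
  apply: (mulIf D0); rewrite /al mulrAC divfK //; apply/eqP; rewrite eq_sym -subr_eq0; apply/eqP.
  rewrite -[RHS](subrr 0) -{1}c1 -c2 /D /N.
  by move: (x1 / y1) (x2 / y2) (y1^-1) (y2^-1) => z1 z2 w1 w2; ring.
have x20 : x2 - x1 != 0 by rewrite subr_eq0 eq_sym.
apply: (mulIf x20); rewrite mul0r.
transitivity (y2 * (y1^-1 - y2^-1 - al * (x1 / y1 - x2 / y2))); last by rewrite e21 subrr mulr0.
have -> : (al + (y1^-1 - al * (x1 / y1)) * l) * (x2 - x1)
   = al * (x2 - x1) + (y1^-1 - al * (x1 / y1)) * (y2 - y1) by rewrite ey; ring.
by field; rewrite y10 y20.
Qed.

Lemma in_kernel_add P Q : on_curve W P -> on_curve W Q ->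
  in_kernel P -> in_kernel Q -> in_kernel (raw_add W P Q).
Proof.
case: P Q => [|x1 y1] [|x2 y2] // h1 h2 k1 k2.
have [[-> //]|[l [ey hs hd ->]]] := raw_add_affine h1 h2.
have [al [be [mal mbe e1 el]]] := kernel_line h1 h2 k1 k2 ey hs hd.
rewrite /chord; set x3 := (l ^+ 2 + _ - _ - _ - _) => /=.
apply/negP => i3; have h3 := on_line_curve h1 hs (erefl x3).
have i3y := integral_y h3 i3.
move/negP: (pmax1 pr); apply.
rewrite (_ : 1 = al * x3 + be * (l * (x3 - x1) + y1)); first by mem_m.
transitivity (al * x1 + be * y1 + (al + be * l) * (x3 - x1)); last by ring.
by rewrite e1 el mul0r addr0.
Qed.

End KernelOfReduction.

Definition ecgroup (K : fieldType) (W : weierstrass K) (dW : disc W != 0) : Type :=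
  ecpoint W.

Section EcGroup.
Variables (K : fieldType) (W : weierstrass K) (dW : disc W != 0).
HB.instance Definition _ := gen_eqMixin (ecgroup dW).
HB.instance Definition _ := gen_choiceMixin (ecgroup dW).
HB.instance Definition _ := GRing.isZmodule.Build (ecgroup dW)
  (ecaddA dW) (ecaddC dW) (@ecadd0 K W) (@ecaddN K W).
End EcGroup.

Lemma disc_base_change (E : weierstrass int) : disc (base_change rat E) = (disc E)%:~R.
Proof.
by rewrite /disc /=; ring.
Qed.

Lemma absz_subn_le (i j a : nat) : (i < a)%N -> (j < a)%N ->
  (`|(i%:Z - j%:Z)%R| <= a.-1.*2)%N.
Proof. by lia. Qed.

Lemma absz_addn_le (i j a : nat) : (i < a)%N -> (j < a)%N ->
  (`|(i%:Z + j%:Z)%R| <= a.-1.*2)%N.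
Proof. by lia. Qed.

Lemma addz_nat_eq0 (i j : nat) : i%:Z + j%:Z = 0 -> i = j.
Proof. by lia. Qed.

Section ReductionKernel.
Variables (E : weierstrass int).
Local Notation W := (base_change rat E).
Hypothesis dW : disc W != 0.
Local Notation G := (ecgroup dW).
Variables (p : nat) (pr : prime p).
Hypothesis good : ~~ (p %| `|disc E|)%N.
Local Notation O := (pint pr).
Local Notation m := (pmax pr).
Implicit Types P Q : G.

Definition reduction_kernel : {pred G} := fun P => in_kernel pr (val (P : ecpoint W)).

Let O1 : a1 W \in O. Proof. exact: pint_int. Qed.
Let O2 : a2 W \in O. Proof. exact: pint_int. Qed.
Let O3 : a3 W \in O. Proof. exact: pint_int. Qed.
Let O4 : a4 W \in O. Proof. exact: pint_int. Qed.
Let O6 : a6 W \in O. Proof. exact: pint_int. Qed.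
Let gW : disc W \notin m. Proof. by rewrite disc_base_change pmax_int. Qed.

Lemma reduction_kernelN P : (- P \in reduction_kernel) = (P \in reduction_kernel).
Proof. by case: P => [[|x y] hP]. Qed.

Lemma reduction_kernel_zmod : zmod_closed reduction_kernel.
Proof.
split=> // P Q hP; rewrite -reduction_kernelN => hQ.
exact: (in_kernel_add O1 O2 O3 O4 O6 (valP (P : ecpoint W)) (valP (- Q : ecpoint W))).
Qed.
HB.instance Definition _ := GRing.isZmodClosed.Build G reduction_kernel
  reduction_kernel_zmod.

Lemma kernel_add_affine P Q x1 y1 x2 y2 :
  val (P : ecpoint W) = Affine x1 y1 -> val (Q : ecpoint W) = Affine x2 y2 ->
  x1 \in O -> x2 \in O ->
  (P + Q \in reduction_kernel) = (x1 - x2 \in m) && (y1 + y2 + a1 W * x2 + a3 W \in m).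
Proof.
move=> eP eQ i1 i2; have hP := valP (P : ecpoint W); have hQ := valP (Q : ecpoint W).
rewrite -(add_integral O1 O2 O3 O4 O6 gW _ _ i1 i2); last 2 first.
- by rewrite -eP.
- by rewrite -eQ.
by rewrite -eP -eQ.
Qed.

Lemma kernel_sub_affine P Q x1 y1 x2 y2 :
  val (P : ecpoint W) = Affine x1 y1 -> val (Q : ecpoint W) = Affine x2 y2 ->
  x1 \in O -> x2 \in O ->
  (P - Q \in reduction_kernel) = (x1 - x2 \in m) && (y1 - y2 \in m).
Proof.
move=> eP eQ i1 i2; rewrite (@kernel_add_affine _ _ x1 y1 x2 (- y2 - a1 W * x2 - a3 W)) //.
  by rewrite (_ : y1 + _ + _ + _ = y1 - y2) //; ring.
by rewrite [LHS]/= eQ.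
Qed.

Lemma reduce_eq P Q :
  reduce pr (P : ecpoint W) = reduce pr (Q : ecpoint W) <-> P - Q \in reduction_kernel.
Proof.
have kP R : (R \in reduction_kernel) = in_kernel pr (val (R : ecpoint W)) by [].
have inf (R : G) : R \in reduction_kernel -> val (reduce pr (R : ecpoint W)) = Infinity.
  by rewrite kP /=; case: (val _) => //= x y; rewrite negbK => ->.
have fin (R : G) : R \notin reduction_kernel -> exists x y,
    [/\ val (R : ecpoint W) = Affine x y, x \in O &
        val (reduce pr (R : ecpoint W)) = Affine (ratr x) (ratr y)].
  rewrite kP /=; case: (val _) => //= x y; rewrite negbK => hx.
  by exists x, y; split=> //; rewrite (negbTE hx).
have [kerP|nP] := boolP (P \in reduction_kernel);
  have [kerQ|nQ] := boolP (Q \in reduction_kernel).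
- split=> _; first exact: rpredB.
  by apply: val_inj; rewrite !inf.
- split=> [/(congr1 val)|h].
    by rewrite inf //; have [x [y [_ _ ->]]] := fin _ nQ.
  by case/negP: nQ; rewrite -(subKr P Q) rpredB.
- split=> [/(congr1 val)|h].
    by rewrite (inf Q) //; have [x [y [_ _ ->]]] := fin _ nP.
  by case/negP: nP; rewrite -(subrK Q P) rpredD.
have [x1 [y1 [eP i1 rP]]] := fin _ nP; have [x2 [y2 [eQ i2 rQ]]] := fin _ nQ.
have j1 : y1 \in O.
  by apply: (integral_y O1 O2 O3 O4 O6 _ i1); rewrite -eP; exact: valP (P : ecpoint W).
have j2 : y2 \in O.
  by apply: (integral_y O1 O2 O3 O4 O6 _ i2); rewrite -eQ; exact: valP (Q : ecpoint W).
rewrite (kernel_sub_affine eP eQ) // -!ratr_Fp_eq //; split.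
  have inj (a b c d : 'F_p) : Affine a b = Affine c d -> a = c /\ b = d by case.
  by move=> /(congr1 val); rewrite rP rQ => /inj[-> ->]; rewrite !eqxx.
move=> /andP[/eqP ex /eqP ey]; by apply: val_inj; rewrite rP rQ ex ey.
Qed.

Definition reduced_x P : option 'F_p :=
  if val (P : ecpoint W) is Affine x _ then
    if x \in O then Some (ratr x) else None else None.

Lemma reduced_x_eq P Q : reduced_x P = reduced_x Q ->
  P - Q \in reduction_kernel \/ P + Q \in reduction_kernel.
Proof.
have kP R : (R \in reduction_kernel) = in_kernel pr (val (R : ecpoint W)) by [].
have inf (R : G) : reduced_x R = None -> R \in reduction_kernel.
  by rewrite kP /reduced_x; case: (val _) => //= x y; case: ifP => // ->.
case eQ : (reduced_x Q) => [u|] eP; last by left; apply: rpredB; exact: inf.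
have fin (R : G) : reduced_x R = Some u -> exists x y,
    [/\ val (R : ecpoint W) = Affine x y, x \in O & ratr x = u].
  rewrite /reduced_x; case: (val _) => //= x y; case: ifP => // hx [<-].
  by exists x, y.
have [x1 [y1 [vP i1 r1]]] := fin _ eP; have [x2 [y2 [vQ i2 r2]]] := fin _ eQ.
have hP : on_curve W (Affine x1 y1) by rewrite -vP; exact: valP (P : ecpoint W).
have hQ : on_curve W (Affine x2 y2) by rewrite -vQ; exact: valP (Q : ecpoint W).
have j1 := integral_y O1 O2 O3 O4 O6 hP i1; have j2 := integral_y O1 O2 O3 O4 O6 hQ i2.
have mx : x1 - x2 \in m by rewrite -ratr_Fp_eq // r1 r2.
rewrite (kernel_sub_affine vP vQ) // (kernel_add_affine vP vQ) // mx /=.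
have [|my] := boolP (y1 - y2 \in m); [by left | right].
have iy : y1 - y2 \in O by mem_O.
have y0 : y1 - y2 != 0 by apply: contraNneq my => ->; exact: rpred0.
rewrite -[X in X \in _](mulKf y0).
have iV := pintV iy my; apply: pmaxMl => //.
rewrite (_ : _ * _ = (x1 - x2) * (x1 ^+ 2 + x1 * x2 + x2 ^+ 2 + a2 W * (x1 + x2) + a4 W - a1 W * y1)).
  by mem_m.
by have := diff_on_curve hP hQ => /(congr1 -%R); rewrite -!mulNr !opprB.
Qed.

Lemma finite_reduced_x : #|{: option 'F_p}| = p.+1.
Proof. by rewrite card_option card_Fp. Qed.

(* Pigeonhole on the x-coordinates modulo p, which identify a point with its
   opposite, hence the factor 2. *)
Lemma kernel_relation (P Q : G) (a b : nat) : (p.+1 < a * b)%N ->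
  exists u v : int, [/\ (u != 0) || (v != 0), (`|u| <= a.-1.*2)%N, (`|v| <= b.-1.*2)%N &
    P *~ u + Q *~ v \in reduction_kernel].
Proof.
move=> hab.
pose f (ij : 'I_a * 'I_b) := reduced_x (P *+ ij.1 + Q *+ ij.2).
have /injectivePn [[i j] [[i' j'] nij]] : ~~ injectiveb f.
  apply/negP => /injectiveP finj; have := leq_card f finj.
  by rewrite finite_reduced_x card_prod !card_ord leqNgt hab.
have li := ltn_ord i; have li' := ltn_ord i'.
have lj := ltn_ord j; have lj' := ltn_ord j'.
rewrite /f /= => /reduced_x_eq [h|h].
- exists (i%:Z - i'%:Z), (j%:Z - j'%:Z); split; last first.
  + by move: h; rewrite opprD addrACA !pmulrn -!mulrzBr.
  + exact: absz_subn_le.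
  + exact: absz_subn_le.
  rewrite -negb_and !subr_eq0; apply: contra nij => /andP[/eqP [ei] /eqP [ej]].
  by apply/eqP; congr pair; apply: val_inj.
- exists (i%:Z + i'%:Z), (j%:Z + j'%:Z); split; last first.
  + by move: h; rewrite addrACA !pmulrn -!mulrzDr.
  + exact: absz_addn_le.
  + exact: absz_addn_le.
  rewrite -negb_and; apply: contra nij => /andP[/eqP ei /eqP ej].
  by apply/eqP; congr pair; apply: val_inj; apply: addz_nat_eq0.
Qed.

End ReductionKernel.

(** * Heights *)

Section AbscissaFormulas.
Variables (K : fieldType) (W : weierstrass K).

Let b2 := a1 W ^+ 2 + 4 * a2 W.
Let b4 := 2 * a4 W + a1 W * a3 W.
Let b6 := a3 W ^+ 2 + 4 * a6 W.
Let b8 := a1 W ^+ 2 * a6 W + 4 * a2 W * a6 W - a1 W * a3 W * a4 W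
          + a2 W * a3 W ^+ 2 - a4 W ^+ 2.

Lemma double_denominator x y : on_curve W (Affine x y) ->
  (2 * y + a1 W * x + a3 W) ^+ 2 = 4 * x ^+ 3 + b2 * x ^+ 2 + 2 * b4 * x + b6.
Proof.
move=> /eqP h; have e6 : a6 W = y ^+ 2 + a1 W * x * y + a3 W * y
  - (x ^+ 3 + a2 W * x ^+ 2 + a4 W * x) by rewrite h; ring.
by rewrite /b2 /b4 /b6 e6; ring.
Qed.

Lemma double_numerator x y l : on_curve W (Affine x y) -> slope_rel W l x y x ->
  (l ^+ 2 + a1 W * l - a2 W - x - x) * (4 * x ^+ 3 + b2 * x ^+ 2 + 2 * b4 * x + b6)
  = x ^+ 4 - b4 * x ^+ 2 - 2 * b6 * x - b8.
Proof.
move=> h hs; rewrite -(double_denominator h); move/eqP: h => h.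
have e4 : a4 W = l * (2 * y + l * (x - x) + a1 W * x + a3 W)
     - (x ^+ 2 + x * x + x ^+ 2 + a2 W * (x + x) - a1 W * y) by rewrite hs; ring.
have e6 : a6 W = y ^+ 2 + a1 W * x * y + a3 W * y
  - (x ^+ 3 + a2 W * x ^+ 2 + a4 W * x) by rewrite h; ring.
by rewrite /b8 /b4 /b6 e6 e4; ring.
Qed.

(* The other root is the abscissa of the difference of the two points; the
   coefficients do not involve the ordinates. *)
Lemma add_quadratic x1 y1 x2 l (X := l ^+ 2 + a1 W * l - a2 W - x1 - x2) :
  on_curve W (Affine x1 y1) -> slope_rel W l x1 y1 x2 ->
  (x1 - x2) ^+ 2 * X ^+ 2
  - (2 * x1 * x2 * (x1 + x2) + b2 * x1 * x2 + b4 * (x1 + x2) + b6) * X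
  + (x1 ^+ 2 * x2 ^+ 2 - b4 * x1 * x2 - b6 * (x1 + x2) - b8) = 0.
Proof.
move=> /eqP h hs.
have e4 : a4 W = l * (2 * y1 + l * (x2 - x1) + a1 W * x2 + a3 W)
     - (x1 ^+ 2 + x1 * x2 + x2 ^+ 2 + a2 W * (x1 + x2) - a1 W * y1) by rewrite hs; ring.
have e6 : a6 W = y1 ^+ 2 + a1 W * x1 * y1 + a3 W * y1
                 - (x1 ^+ 3 + a2 W * x1 ^+ 2 + a4 W * x1) by rewrite h; ring.
by rewrite /X /b8 /b2 /b4 /b6 e6 e4; ring.
Qed.

End AbscissaFormulas.

Section RationalHeight.

Definition rat_height (x : rat) : int := Num.max `|numq x| (denq x).

Lemma rat_height_ge1 x : 1 <= rat_height x.
Proof. by rewrite le_max (_ : 1 <= denq x) ?orbT // -gtz0_ge1 denq_gt0. Qed.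

Lemma absz_le_dvdn (a b : int) : b != 0 -> (`|a| %| `|b|)%N -> `|a| <= `|b|.
Proof. by move=> b0 /dvdn_leq; rewrite absz_gt0 => /(_ b0) h; rewrite -!abszE lez_nat. Qed.

Lemma rat_height_frac (x : rat) (a b : int) (h : int) : b != 0 ->
  x * b%:~R = a%:~R -> `|a| <= h -> `|b| <= h -> rat_height x <= h.
Proof.
move=> b0 e ha hb; have b0' : b%:~R != 0 :> rat by rewrite intr_eq0.
have ex : x = a%:~R / b%:~R by rewrite -e mulfK.
have := congr1 absz (frac_cross b0 ex); rewrite !abszM => en.
rewrite ge_max; apply/andP; split.
  have [n0|n0] := eqVneq (numq x) 0; first by rewrite n0 normr0 (le_trans _ hb).
  have a0 : a != 0 by rewrite -(intr_eq0 rat) -e mulf_neq0 // -numq_eq0.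
  apply: le_trans (absz_le_dvdn a0 _) ha.
  by rewrite -(Gauss_dvdl _ (coprime_num_den x)) -en dvdn_mulr.
rewrite -(ger0_norm (denq_ge0 x)); apply: le_trans (absz_le_dvdn b0 _) hb.
rewrite -(@Gauss_dvdr _ `|numq x|) ?en ?dvdn_mull //.
by rewrite coprime_sym coprime_num_den.
Qed.

Lemma rat_height_root (x : rat) (q2 q1 q0 : int) : q2 != 0 ->
  q2%:~R * x ^+ 2 + q1%:~R * x + q0%:~R = 0 ->
  rat_height x <= `|q2| * (1 + `|q1| + `|q0|).
Proof.
move=> q20 e; set n := numq x; set d := denq x.
have d0 : (d%:~R : rat) != 0 by rewrite intr_eq0 denq_neq0.
have ez : q2 * n ^+ 2 + q1 * n * d + q0 * d ^+ 2 = 0.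
  apply: (@intr_inj rat).
  have ex : x = n%:~R / d%:~R by rewrite divq_num_den.
  transitivity ((q2%:~R * x ^+ 2 + q1%:~R * x + q0%:~R) * d%:~R ^+ 2); last first.
    by rewrite e mul0r.
  by rewrite ex !(rmorphD, rmorphM, rmorphXn) /=; field.
have dgt0 : 0 < d by rewrite denq_gt0.
have hd : d <= `|q2|.
  rewrite -(ger0_norm (ltW dgt0)); apply: absz_le_dvdn q20 _.
  have cop : coprime `|d| (`|n| ^ 2) by rewrite coprimeXr // coprime_sym coprime_num_den.
  rewrite -(Gauss_dvdl _ cop) -abszX -abszM.
  have -> : q2 * n ^+ 2 = d * (- (q1 * n + q0 * d)).
    by apply/eqP; rewrite -subr_eq0 -ez; apply/eqP; ring.
  by rewrite abszM dvdn_mulr.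
have q21 : 1 <= `|q2| by rewrite -gtz0_ge1 normr_gt0.
have hn : `|n| <= d * (1 + `|q1| + `|q0|).
  have [le|gt] := leP `|n| d.
    by apply: le_trans le _; rewrite ler_peMr ?(ltW dgt0) //; have := normr_ge0 q1; have := normr_ge0 q0; lia.
  have n0 : 0 < `|n| by apply: lt_trans gt.
  have : `|q2| * `|n| ^+ 2 <= (`|q1| + `|q0|) * (`|n| * d).
    have -> : `|q2| * `|n| ^+ 2 = `|q1 * n * d + q0 * d ^+ 2|.
      have -> : q1 * n * d + q0 * d ^+ 2 = - (q2 * n ^+ 2).
        by apply/eqP; rewrite -subr_eq0 opprK -ez; apply/eqP; ring.
      by rewrite normrN normrM normrX.
    apply: le_trans (ler_normD _ _) _; rewrite mulrDl !normrM.
    rewrite (ger0_norm (ltW dgt0)) -mulrA lerD2l ler_wpM2l // ler_wpM2r ?(ltW dgt0) //.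
    exact: ltW.
  rewrite (_ : `|q2| * _ = `|n| * (`|q2| * `|n|)); last by ring.
  rewrite [leRHS](_ : _ = `|n| * ((`|q1| + `|q0|) * d)); last by ring.
  rewrite ler_pM2l // => h3.
  have h4 : `|n| <= `|q2| * `|n| by rewrite ler_peMl.
  apply: le_trans h4 (le_trans h3 _); rewrite mulrC ler_wpM2l ?(ltW dgt0) //; lia.
rewrite ge_max; apply/andP; split.
  by apply: le_trans hn _; rewrite ler_wpM2r //; have := normr_ge0 q1; have := normr_ge0 q0; lia.
by apply: le_trans hd _; rewrite ler_peMr //; have := normr_ge0 q1; have := normr_ge0 q0; lia.
Qed.

Lemma monomial_bound (c a b h : int) (i j : nat) : `|a| <= h -> `|b| <= h ->
  `|c * a ^+ i * b ^+ j| <= `|c| * h ^+ (i + j).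
Proof.
move=> ha hb; have h0 : 0 <= h := le_trans (normr_ge0 a) ha.
rewrite -mulrA !normrM ler_wpM2l // !normrX exprD.
by apply: ler_pM; rewrite ?exprn_ge0 //; apply: lerXn2r; rewrite ?nnegrE.
Qed.

Lemma form2_bound (c2 c1 c0 a b h : int) : `|a| <= h -> `|b| <= h ->
  `|c2 * a ^+ 2 + c1 * a * b + c0 * b ^+ 2| <= (`|c2| + `|c1| + `|c0|) * h ^+ 2.
Proof.
move=> ha hb; rewrite !mulrDl.
have := monomial_bound c2 2 0 ha hb; have := monomial_bound c1 1 1 ha hb.
have := monomial_bound c0 0 2 ha hb; rewrite !expr0 !mulr1 !expr1 => h0 h1 h2.
by do 2?[apply: le_trans (ler_normD _ _) _; apply: lerD => //].
Qed.

Lemma form4_bound (c4 c3 c2 c1 c0 a b h : int) : `|a| <= h -> `|b| <= h ->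
  `|c4 * a ^+ 4 + c3 * a ^+ 3 * b + c2 * a ^+ 2 * b ^+ 2 + c1 * a * b ^+ 3
    + c0 * b ^+ 4| <= (`|c4| + `|c3| + `|c2| + `|c1| + `|c0|) * h ^+ 4.
Proof.
move=> ha hb; rewrite !mulrDl.
have := monomial_bound c4 4 0 ha hb; have := monomial_bound c3 3 1 ha hb.
have := monomial_bound c2 2 2 ha hb; have := monomial_bound c1 1 3 ha hb.
have := monomial_bound c0 0 4 ha hb; rewrite !expr0 !mulr1 !expr1 => h0 h1 h2 h3 h4.
by do 4?[apply: le_trans (ler_normD _ _) _; apply: lerD => //].
Qed.

End RationalHeight.

Lemma ln_le_mulXn (R : realType) (C h H : int) (n : nat) : 1 <= H -> 1 <= C -> 1 <= h ->
  H <= C * h ^+ n -> ln (H%:~R : R) <= n%:R * ln h%:~R + ln C%:~R.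
Proof.
move=> H1 C1 h1 le.
have pos (z : int) : 1 <= z -> (0 : R) < z%:~R by move=> z1; rewrite ltr0z (lt_le_trans _ z1).
rewrite addrC mulr_natl -lnXn ?pos // -lnM ?posrE ?exprn_gt0 ?pos //.
by rewrite ler_ln ?posrE ?mulr_gt0 ?exprn_gt0 ?pos // -rmorphXn -rmorphM ler_int.
Qed.

Lemma ub2_int (a b : int) : exists C : int, [/\ 1 <= C, a <= C & b <= C].
Proof. by exists (1 + `|a| + `|b|); split; lia. Qed.

Section LogHeight.
Variables (R : realType) (E : weierstrass int).
Local Notation W := (base_change rat E).
Hypothesis dW : disc W != 0.
Local Notation G := (ecgroup dW).
Implicit Types P Q T : G.

Definition lheight P : R := log_height R (P : ecpoint W).

Lemma lheight_affine P x y : val (P : ecpoint W) = Affine x y ->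
  lheight P = ln (rat_height x)%:~R.
Proof. by rewrite /lheight /log_height => ->. Qed.

Lemma lheight_chord P l x1 y1 x2 : val (P : ecpoint W) = chord W l x1 y1 x2 ->
  lheight P = ln (rat_height (l ^+ 2 + a1 W * l - a2 W - x1 - x2))%:~R.
Proof. exact: lheight_affine. Qed.

Lemma lheight_infinity P : val (P : ecpoint W) = Infinity -> lheight P = 0.
Proof. by rewrite /lheight /log_height => ->. Qed.

Lemma lheight0 : lheight 0 = 0. Proof. exact: lheight_infinity. Qed.

Lemma lheight_ge0 P : 0 <= lheight P.
Proof.
rewrite /lheight /log_height; case: (val _) => // x y.
by apply: ln_ge0; rewrite -[1]/(1%:~R) ler_int rat_height_ge1.
Qed.

Let b2 : int := a1 E ^+ 2 + 4 * a2 E.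
Let b4 : int := 2 * a4 E + a1 E * a3 E.
Let b6 : int := a3 E ^+ 2 + 4 * a6 E.
Let b8 : int := a1 E ^+ 2 * a6 E + 4 * a2 E * a6 E - a1 E * a3 E * a4 E
          + a2 E * a3 E ^+ 2 - a4 E ^+ 2.

Lemma num_den_height (x : rat) : exists a b : int, [/\ x = a%:~R / b%:~R, b != 0,
  `|a| <= rat_height x & `|b| <= rat_height x].
Proof.
exists (numq x), (denq x); split; rewrite ?divq_num_den ?denq_neq0 //.
  by rewrite le_max lexx.
by rewrite ger0_norm ?denq_ge0 // le_max lexx orbT.
Qed.

Lemma lheight_double : exists2 c : R, 0 <= c &
  forall P, lheight (P + P) <= 4 * lheight P + c.
Proof.
have [C [C1 CA CB]] := ub2_int
  (`|1 : int| + `|0 : int| + `|- b4| + `|- 2 * b6| + `|- b8|)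
  (`|0 : int| + `|4 : int| + `|b2| + `|2 * b4| + `|b6|).
exists (ln C%:~R); first by apply: ln_ge0; rewrite -[1]/(1%:~R) ler_int.
move=> P; have lnC0 : 0 <= ln (C%:~R : R) by apply: ln_ge0; rewrite -[1]/(1%:~R) ler_int.
have bd0 : 0 <= 4 * lheight P + ln C%:~R by rewrite addr_ge0 // mulr_ge0 ?lheight_ge0.
case eP : (val (P : ecpoint W)) => [|x y].
  by rewrite (lheight_infinity (P := P + P)) //= eP.
have hP : on_curve W (Affine x y) by rewrite -eP; exact: valP (P : ecpoint W).
have eD : val (P + P : ecpoint W) = raw_add W (Affine x y) (Affine x y) by rewrite /= eP.
have [[e _]|[l [_ hs hd e]]] := raw_add_affine hP hP.
  by rewrite lheight_infinity // eD e.
have [_ d0] := hd erefl.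
rewrite e in eD; rewrite (lheight_chord (P := P + P) eD) (lheight_affine eP).
apply: ln_le_mulXn; rewrite ?rat_height_ge1 //.
have [a [b [ex bn0 ha hb]]] := num_den_height x.
have hn := double_numerator hP hs; have hden := double_denominator hP.
have bn0' : b%:~R != 0 :> rat by rewrite intr_eq0.
pose A := 1 * a ^+ 4 + 0 * a ^+ 3 * b + (- b4) * a ^+ 2 * b ^+ 2 + (- 2 * b6) * a * b ^+ 3 + (- b8) * b ^+ 4.
pose B := 0 * a ^+ 4 + 4 * a ^+ 3 * b + b2 * a ^+ 2 * b ^+ 2 + (2 * b4) * a * b ^+ 3 + b6 * b ^+ 4.
have eB : B%:~R = (2 * y + a1 W * x + a3 W) ^+ 2 * b%:~R ^+ 4.
  by rewrite hden ex /B /b2 /b4 /b6 /=; field.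
have hC4 : 0 <= rat_height x ^+ 4 by rewrite exprn_ge0 // (le_trans _ (rat_height_ge1 x)).
apply: (@rat_height_frac _ A B).
- by rewrite -(intr_eq0 rat) eB mulf_neq0 // expf_neq0.
- rewrite eB hden mulrA hn ex /A /b4 /b6 /b8 /=; field; exact: bn0'.
- by apply: le_trans (form4_bound _ _ _ _ _ ha hb) _; apply: ler_wpM2r.
- by apply: le_trans (form4_bound _ _ _ _ _ ha hb) _; apply: ler_wpM2r.
Qed.

Lemma lheight_add Q : exists2 B : R, 0 <= B &
  forall P, lheight (P + Q) <= 4 * lheight P + B.
Proof.
case eQ : (val (Q : ecpoint W)) => [|x0 y0].
  exists 0 => // P; have -> : Q = 0 by apply: val_inj.
  by rewrite addr0; have := lheight_ge0 P; lra.
have hQ : on_curve W (Affine x0 y0) by rewrite -eQ; exact: valP (Q : ecpoint W).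
have [a0 [b0 [ex0 bn0 _ _]]] := num_den_height x0.
pose C2 : int := `|b0 ^+ 2| + `|- 2 * a0 * b0| + `|a0 ^+ 2|.
pose C1 : int := `|- (2 * a0 * b0)| + `|- (2 * a0 ^+ 2 + b2 * a0 * b0 + b4 * b0 ^+ 2)|
   + `|- (b4 * a0 * b0 + b6 * b0 ^+ 2)|.
pose C0 : int := `|a0 ^+ 2| + `|- b4 * a0 * b0 - b6 * b0 ^+ 2|
   + `|- b6 * a0 * b0 - b8 * b0 ^+ 2|.
have C2p : 1 <= C2.
  rewrite /C2 -addrA -[X in X <= _]addr0; apply: lerD; last exact: addr_ge0.
  by rewrite -gtz0_ge1 normr_gt0 expf_neq0.
pose C := C2 * (1 + C1 + C0).
have C1p : 0 <= C1 by rewrite !addr_ge0.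
have C0p : 0 <= C0 by rewrite !addr_ge0.
have Cp : 1 <= C by rewrite /C mulr_ege1 // -addrA lerDl addr_ge0.
have lnC0 : 0 <= ln (C%:~R : R) by apply: ln_ge0; rewrite -[1]/(1%:~R) ler_int.
have g1 := lheight_ge0 Q; have g2 := lheight_ge0 (Q + Q).
exists (ln C%:~R + lheight Q + lheight (Q + Q)); first by lra.
move=> P; have g0 := lheight_ge0 P.
case eP : (val (P : ecpoint W)) => [|x y].
  have -> : P = 0 by apply: val_inj.
  by rewrite add0r lheight0; lra.
have hP : on_curve W (Affine x y) by rewrite -eP; exact: valP (P : ecpoint W).
have eD : val (P + Q : ecpoint W) = raw_add W (Affine x y) (Affine x0 y0) by rewrite /= eP eQ.
have [[e _]|[l [_ hs hd e]]] := raw_add_affine hP hQ.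
  by rewrite lheight_infinity ?eD ?e //; lra.
have [ex|nx] := eqVneq x x0.
  have [ey _] := hd ex; have -> : P = Q by apply: val_inj; rewrite eP eQ ex ey -?ex.
  by lra.
rewrite e in eD; rewrite (lheight_chord (P := P + Q) eD) (lheight_affine eP).
suff : ln ((rat_height (l ^+ 2 + a1 W * l - a2 W - x - x0))%:~R : R)
    <= 4%:R * ln (rat_height x)%:~R + ln C%:~R by move=> /=; lra.
have h1 := rat_height_ge1 x.
apply: ln_le_mulXn; rewrite ?rat_height_ge1 //.
have [a [b [ex bn ha hb]]] := num_den_height x.
have quad := add_quadratic hP hs.
have bn' : b%:~R != 0 :> rat by rewrite intr_eq0.
have bn0' : b0%:~R != 0 :> rat by rewrite intr_eq0.
pose q2 := b0 ^+ 2 * a ^+ 2 + (- 2 * a0 * b0) * a * b + a0 ^+ 2 * b ^+ 2.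
pose q1 := (- (2 * a0 * b0)) * a ^+ 2 + (- (2 * a0 ^+ 2 + b2 * a0 * b0 + b4 * b0 ^+ 2)) * a * b
   + (- (b4 * a0 * b0 + b6 * b0 ^+ 2)) * b ^+ 2.
pose q0 := a0 ^+ 2 * a ^+ 2 + (- b4 * a0 * b0 - b6 * b0 ^+ 2) * a * b
   + (- b6 * a0 * b0 - b8 * b0 ^+ 2) * b ^+ 2.
have eq2 : q2%:~R = (x - x0) ^+ 2 * (b%:~R * b0%:~R) ^+ 2.
  by rewrite ex ex0 /q2; field; rewrite bn' bn0'.
have q20 : q2 != 0.
  by rewrite -(intr_eq0 rat) eq2 mulf_neq0 // expf_neq0 ?subr_eq0 // mulf_neq0.
apply: le_trans (rat_height_root (q1 := q1) (q0 := q0) q20 _) _.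
  rewrite eq2.
  transitivity (0 * (b%:~R * b0%:~R) ^+ 2 : rat); last by rewrite mul0r.
  rewrite -quad; move: (l ^+ 2 + _ - _ - _ - _) => X.
  by rewrite ex ex0 /q1 /q0 /b2 /b4 /b6 /b8 /=; field; rewrite bn' bn0'.
have h2 := form2_bound (b0 ^+ 2) (- 2 * a0 * b0) (a0 ^+ 2) ha hb.
have h3 := form2_bound (- (2 * a0 * b0)) (- (2 * a0 ^+ 2 + b2 * a0 * b0 + b4 * b0 ^+ 2))
  (- (b4 * a0 * b0 + b6 * b0 ^+ 2)) ha hb.
have h4 := form2_bound (a0 ^+ 2) (- b4 * a0 * b0 - b6 * b0 ^+ 2)
  (- b6 * a0 * b0 - b8 * b0 ^+ 2) ha hb.
rewrite -/q2 -/C2 in h2; rewrite -/q1 -/C1 in h3; rewrite -/q0 -/C0 in h4.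
have hs1 : 1 <= rat_height x ^+ 2 by rewrite exprn_ege1.
rewrite (_ : C * _ = (C2 * rat_height x ^+ 2) * ((1 + C1 + C0) * rat_height x ^+ 2)); last first.
  by rewrite /C; ring.
apply: ler_pM => //.
rewrite [leRHS](_ : _ = rat_height x ^+ 2 + C1 * rat_height x ^+ 2 + C0 * rat_height x ^+ 2).
  by do 2?[apply: lerD].
by rewrite (mulrDl (1 + C1)) (mulrDl 1) mul1r.
Qed.

Lemma lheight_mul P : exists2 K : R, 0 <= K &
  forall n, lheight (P *+ n) <= K * n%:R ^+ 4.
Proof.
have [c c0 hc] := lheight_double; have [B B0 hB] := lheight_add P.
have p0 := lheight_ge0 P.
exists (lheight P + B + c); first by lra.
move=> n; set K := lheight P + B + c.
suff : (0 < n)%N -> lheight (P *+ n) + B + c <= K * n%:R ^+ 4.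
  case: n => [_|n /(_ isT)]; last by lra.
  by rewrite mulr0n lheight0 expr0n /= mulr0.
have [k] := ubnP n; elim: k n => // k IH n /ltnSE le_nk n0.
have [n1|n1] := leqP n 1.
  by have -> : n = 1%N by [apply/eqP; rewrite eqn_leq n1]; rewrite mulr1n expr1n mulr1.
have m0 : (0 < n./2)%N by rewrite half_gt0.
have mk : (n./2 < k)%N by apply: leq_trans le_nk; rewrite ltn_half_double -addnn -[X in (X < _)%N]addn0 ltn_add2l.
have {IH}IH := IH _ mk m0; move: IH; set m := n./2 => IH.
have g := lheight_ge0 (P *+ m).
have h2 : lheight (P *+ m.*2) <= 4 * lheight (P *+ m) + c by rewrite -addnn mulrnDr.
have K0 : 0 <= K by rewrite /K; lra.
have en := odd_double_half n; rewrite -/m in en.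
have le16 : 16 * (K * m%:R ^+ 4) <= K * n%:R ^+ 4.
  rewrite mulrCA ler_wpM2l // (_ : 16 = 2 ^+ 4) -?exprMn; last by ring.
  rewrite lerXn2r ?nnegrE ?mulr_ge0 // -natrM ler_nat -en mul2n; exact: leq_addl.
have : lheight (P *+ n) <= 16 * lheight (P *+ m) + 4 * c + B.
  rewrite -en; case: (odd n) => /=; last by rewrite add0n; lra.
  by rewrite mulrS addrC; apply: le_trans (hB _) _; lra.
by lra.
Qed.

(* Convergence of Tate's sequence is not needed for an upper bound: the limit of a
   divergent sequence is the default element [point]. *)
Lemma canonical_height_le : exists2 c : R, 0 <= c &
  forall P, canonical_height R (P : ecpoint W) <= lheight P / 2 + c.
Proof.
have [c c0 hc] := lheight_double.
exists (c / 2 + `|point : R|); first by rewrite addr_ge0 // divr_ge0.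
move=> P; have p0 := lheight_ge0 P; have n0 := normr_ge0 (point : R).
have dbl n : lheight (iter n (fun T : G => T + T) P) + c <= 4 ^+ n * (lheight P + c).
  elim: n => [|n IH]; first by rewrite expr0 mul1r.
  by rewrite exprS -mulrA /=; have := hc (iter n (fun T : G => T + T) P); lra.
rewrite /canonical_height; set u := fun n : nat => _.
have hu n : u n <= (lheight P + c) / 2.
  rewrite /u ler_pdivrMr ?mulr_gt0 ?exprn_gt0 //.
  have := dbl n; rewrite /lheight => h.
  rewrite mulrA divfK ?pnatr_eq0 // mulrC.
  by apply: le_trans h; rewrite lerDl.
have [cu|/dvgP ->] := pselect (cvg (u @ \oo)).
  have : lim (u @ \oo) <= (lheight P + c) / 2 by apply: limr_le => //; apply: nearW.
  by lra.
by apply: le_trans (ler_norm _) _; lra.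
Qed.

End LogHeight.

(** * The multiplier *)

Lemma expn2_size_primes (d : nat) : (0 < d)%N -> (2 ^ size (primes d) <= d)%N.
Proof.
move=> d0; rewrite [X in (_ <= X)%N](prod_prime_decomp d0) /primes size_map.
have : all (fun f => 2 <= f.1 ^ f.2)%N (prime_decomp d).
  apply/allP => -[q e] /mem_prime_decomp /= [pq e0 _].
  apply: leq_trans (prime_gt1 pq) _.
  by case: e e0 => // e _; rewrite expnS leq_pmulr // expn_gt0 prime_gt0.
elim: (prime_decomp d) => [|f s IH] /=; first by rewrite big_nil.
by move=> /andP[h /IH hs]; rewrite big_cons expnS leq_mul.
Qed.

Lemma leq_fact_expn (n : nat) : (n`! <= n ^ n)%N.
Proof.
rewrite fact_prod -[X in (_ <= _ ^ X)%N](subn1 n.+1) -prod_nat_const_nat.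
by rewrite big_nat_cond [X in (_ <= X)%N]big_nat_cond; apply: leq_prod => i /andP[/andP[_]].
Qed.

Lemma dvdn_int_factor (v : int) (M : nat) : v != 0 -> (`|v| %| M)%N -> exists w : int, M%:Z = v * w.
Proof.
move=> v0 /dvdnP [k ->]; exists (Num.sg v * k%:Z).
by rewrite PoszM abszE normrEsg; ring.
Qed.

Section GroupBridge.
Variables (K : fieldType) (W : weierstrass K) (dW : disc W != 0).
Local Notation G := (ecgroup dW).

Lemma ecmulzE (P : G) (k : int) : ecmulz (P : ecpoint W) k = P *~ k.
Proof.
have h n : iter n (ecadd (P : ecpoint W)) (ec0 W) = P *+ n.
  by elim: n => // n IH; rewrite iterS IH mulrS.
by case: k => n; rewrite /ecmulz h ?NegzE ?mulrNz.
Qed.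

Lemma independent_sum n (P : 'I_n -> G) : independent (fun i => P i : ecpoint W) ->
  forall m : 'I_n -> int, \sum_(i < n) P i *~ m i = 0 -> forall i, m i = 0.
Proof.
move=> ind m e; apply: ind; rewrite -[RHS]e.
by apply: eq_bigr => i _; apply: ecmulzE.
Qed.

Lemma sum_independent n (P : 'I_n -> G) :
  (forall m : 'I_n -> int, \sum_(i < n) P i *~ m i = 0 -> forall i, m i = 0) ->
  independent (fun i => P i : ecpoint W).
Proof.
move=> ind m e; apply: ind; rewrite -[RHS]e.
by apply: eq_bigr => i _; rewrite -ecmulzE.
Qed.

Lemma independent_nontorsion n (P : 'I_n -> G) i k :
  independent (fun i => P i : ecpoint W) -> (0 < k)%N -> P i *+ k != 0.
Proof.
move=> ind k0; apply/eqP => e.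
have := independent_sum ind (m := fun j => if j == i then k%:Z else 0).
rewrite (bigD1 i) //= eqxx -pmulrn e add0r big1 => [|j /negbTE -> //].
by move=> /(_ erefl i); rewrite eqxx => /eqP; rewrite eqz_nat; case: k k0 {e}.
Qed.

Variables (Gamma : set (ecpoint W)).
Hypothesis sG : subgroup Gamma.

Lemma subgroup_mulz (P : G) (k : int) : Gamma P -> Gamma (P *~ k).
Proof.
move=> hP; have [h0 hD hN] := sG.
have hn n : Gamma (P *+ n) by elim: n => // n IH; rewrite mulrS; apply: hD.
by case: k => n; rewrite ?NegzE ?mulrNz -pmulrn; [|apply: hN].
Qed.

Lemma rank_lt_free r s : has_rank [set: ecpoint W] r -> has_rank Gamma s -> (s < r)%N ->
  exists P : G, forall M, (0 < M)%N -> ~ Gamma (P *+ M).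
Proof.
move=> [[P [_ ind]] _] [_ hs] lt; apply: contrapT => hno.
have /choice [M hM] : forall i : 'I_r, exists M, (0 < M)%N /\ Gamma ((P i : G) *+ M).
  move=> i; apply: contrapT => hi; apply: hno; exists (P i) => M M0 hM.
  by apply: hi; exists M.
have := hs r (fun i => (P i : G) *+ M i) (fun i => (hM i).2).
rewrite leqNgt lt => h; suff : false by [].
apply: h; apply: sum_independent => m e i.
have := independent_sum (P := P) ind (m := fun i => (M i)%:Z * m i).
move=> /(_ _ i) => h'; have /eqP : (M i)%:Z * m i = 0.
  by apply: h'; rewrite -[RHS]e; apply: eq_bigr => j _; rewrite mulrzA -pmulrn.
by rewrite mulf_eq0 eqz_nat; have [+ _] := hM i; case: (M i) => //= _ _ /eqP.
Qed.

End GroupBridge.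

Section Multiplier.
Variables (R : realType) (E : weierstrass int).
Local Notation W := (base_change rat E).
Variable dW : disc W != 0.
Local Notation G := (ecgroup dW).
Variables (Gamma : set (ecpoint W)) (P0 P : G).
Hypotheses (sG : subgroup Gamma) (GP0 : Gamma P0)
  (ntP0 : forall k, (0 < k)%N -> P0 *+ k != 0).

Definition x_denominator (Q : G) : nat :=
  if val (Q : ecpoint W) is Affine x _ then `|denq x|%N else 1.

Lemma x_denominator_gt0 Q : (0 < x_denominator Q)%N.
Proof. by rewrite /x_denominator; case: (val _) => // x _; rewrite absz_gt0 denq_neq0. Qed.

Lemma size_primes_denominator Q :
  (size (primes (x_denominator Q)))%:R * ln 2 <= lheight R Q.
Proof.
have h := expn2_size_primes (x_denominator_gt0 Q).
rewrite mulr_natl -lnXn //.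
apply: le_trans (_ : ln (x_denominator Q)%:R <= _).
  by rewrite ler_ln ?posrE ?exprn_gt0 ?ltr0n ?x_denominator_gt0 // -natrX ler_nat.
rewrite /x_denominator /lheight /log_height.
case: (val _) => [|x y]; first by rewrite ln1.
rewrite ler_ln ?posrE ?ltr0n ?absz_gt0 ?denq_neq0 //; last first.
  by rewrite ltr0z lt_max denq_gt0 orbT.
by rewrite -[_%:R]/(`|denq x|%:Z%:~R) ler_int abszE ger0_norm ?denq_ge0 // le_max lexx orbT.
Qed.

(* Relations of kernel_relation with a = 1 have u = 0 and v <> 0. *)
Lemma annihilator (N : nat) (s : seq nat) : exists2 M, (0 < M <= N.*2.+2 ^ size s)%N &
  forall p (pr : prime p), p \in s -> (p <= N)%N -> ~~ (p %| `|disc E|)%N ->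
    P *+ M \in @reduction_kernel E dW p pr.
Proof.
elim: s => [|q s [M /andP[M0 le] hM]]; first by exists 1%N.
have [[pq leq gq]|nq] := pselect [/\ prime q, (q <= N)%N & ~~ (q %| `|disc E|)%N]; last first.
  exists M.
    rewrite M0 (leq_trans le) // leq_pexp2l //.
  move=> p pr; rewrite inE => /orP[/eqP e|ps] lp gp; last exact: hM.
  by case: nq; rewrite -e.
have [u [v [uv /=]]] := kernel_relation pq gq P0 P (a := 1) (b := q.+2) (ltac:(by rewrite mul1n)).
rewrite leqn0 absz_eq0 => /eqP u0 hv; subst u; move: uv; rewrite eqxx /= => v0.
rewrite mulr0z add0r => ker.
exists (`|v| * M)%N.
  rewrite muln_gt0 absz_gt0 v0 M0 /= expnS leq_mul //.
  by apply: leq_trans hv _; rewrite /= -doubleS leq_double ltnS.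
move=> p pr; rewrite inE => /orP[/eqP e|ps] lp gp; last first.
  rewrite mulnC mulrnA; apply: rpredMn; exact: hM.
subst q; rewrite (bool_irrelevance pr pq) mulrnA; apply: rpredMn.
by rewrite pmulrn abszE; case: (ger0P v) => _ //; rewrite mulrNz rpredN.
Qed.

Lemma multiplier : exists2 C : R, 0 <= C & forall N a b, (N.+1 < a * b)%N ->
  exists M : nat, [/\ (0 < M)%N,
    forall p (pr : prime p), (p <= N)%N -> ~~ (p %| `|disc E|)%N ->
      (reduce pr @` Gamma) (reduce pr (P *+ M : ecpoint W)) &
    ln (M%:R : R) <= (b.*2)%:R * ln (b.*2)%:R + C * a%:R ^+ 5 * ln (N.*2.+2)%:R].
Proof.
have [K K0 hK] := lheight_mul R P0.
have ln2 : 0 < ln (2 : R) by rewrite ln_gt0 // ltr1n.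
exists (32 * K / ln 2); first by rewrite divr_ge0 ?mulr_ge0 // ltW.
move=> N a b hab.
have a0 : (0 < a)%N by case: a hab.
have b0 : (0 < b)%N by case: b hab => //; rewrite muln0.
pose s := flatten [seq primes (x_denominator (P0 *+ n)) | n <- iota 1 a.*2].
have [M' /andP[M'0 leM'] hM'] := annihilator N s.
have sizes : (size s)%:R <= 32 * K / ln 2 * a%:R ^+ 5.
  have : all (fun n => n <= a.*2)%N (iota 1 a.*2).
    by apply/allP => n; rewrite mem_iota add1n ltnS => /andP[].
  rewrite mulrAC ler_pdivlMr // size_flatten /shape -map_comp.
  have -> : 32 * K * a%:R ^+ 5 = (size (iota 1 a.*2))%:R * (K * a.*2%:R ^+ 4).
    by rewrite size_iota -muln2 natrM; ring.
  elim: (iota 1 a.*2) => [|n t IH] /=; first by rewrite !mul0r.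
  move=> /andP[hn /IH ht]; rewrite natrD mulrDl -[(size t).+1]add1n natrD [leRHS]mulrDl mul1r.
  apply: lerD ht; apply: le_trans (size_primes_denominator _) _.
  apply: le_trans (hK n) _; rewrite ler_wpM2l // lerXn2r ?nnegrE // ler_nat //.
exists ((b.*2)`! * M')%N; split; first by rewrite muln_gt0 fact_gt0.
  move=> p pr lp gp.
  have lt : (p.+1 < a * b)%N by apply: leq_ltn_trans hab; rewrite ltnS.
  have [u [v [uv hu hv ker]]] := kernel_relation pr gp P0 P lt.
  have [v0|v0] := eqVneq v 0.
    subst v; move: uv; rewrite eqxx orbF => u0; rewrite mulr0z addr0 in ker.
    have ker' : P0 *+ `|u| \in reduction_kernel pr.
      by rewrite pmulrn abszE; case: (ger0P u) => _ //; rewrite mulrNz rpredN.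
    have ps : p \in s.
      apply/flatten_mapP; exists `|u|%N.
        rewrite mem_iota lt0n absz_eq0 u0 add1n ltnS (leq_trans hu) // leq_double leq_pred //.
      rewrite mem_primes pr x_denominator_gt0 /=.
      move: ker'; rewrite /x_denominator -[_ \in _]/(in_kernel _ (val (P0 *+ `|u| : ecpoint W))).
      case eQ : (val _) => [|x y] /=; last by rewrite negbK.
      have /eqP := ntP0 (k := `|u|%N) (ltac:(by rewrite absz_gt0)).
      by case; apply: val_inj.
    exists (ec0 W); first by case: sG.
    apply/esym; apply: (proj2 (reduce_eq pr gp (P *+ ((b.*2)`! * M')) (0 : G))).
    by rewrite subr0 mulnC mulrnA; apply: rpredMn; exact: hM'.
  have [w ew] : exists w : int, ((b.*2)`! * M')%N%:Z = v * w.
    apply: dvdn_int_factor => //; apply: dvdn_mulr; apply: dvdn_fact.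
    by rewrite absz_gt0 v0 (leq_trans hv) // leq_double leq_pred.
  exists (P0 *~ (- (u * w))); first exact: subgroup_mulz.
  apply/esym; apply: (proj2 (reduce_eq pr gp (P *+ ((b.*2)`! * M')) (P0 *~ (- (u * w))))).
  rewrite pmulrn ew mulrNz opprK !mulrzA -mulrzDl addrC; exact: rpredMz.
rewrite natrM lnM ?posrE ?ltr0n ?fact_gt0 //; apply: lerD.
  rewrite mulr_natl -lnXn ?ltr0n ?double_gt0 //.
  rewrite ler_ln ?posrE ?exprn_gt0 ?ltr0n ?fact_gt0 ?double_gt0 //.
  by rewrite -natrX ler_nat leq_fact_expn.
have ln0 : 0 <= ln ((N.*2.+2)%:R : R) by apply: ln_ge0; rewrite ler1n.
apply: le_trans (_ : (size s)%:R * ln (N.*2.+2)%:R <= _); last by rewrite ler_wpM2r.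
rewrite mulr_natl -lnXn ?ltr0n //.
by rewrite ler_ln ?posrE ?exprn_gt0 ?ltr0n // -natrX ler_nat.
Qed.

End Multiplier.

(** * The size of the multiplier *)

Lemma sixth_root (N : nat) : exists a, (a ^ 6 <= N < a.+1 ^ 6)%N.
Proof.
elim: N => [|N [a /andP[le lt]]]; first by exists 0%N.
have [lt'|ge] := ltnP N.+1 (a.+1 ^ 6).
  by exists a; rewrite lt' (leq_trans le).
exists a.+1; rewrite ge /=; apply: leq_ltn_trans lt _.
by rewrite ltn_exp2r.
Qed.

Section Asymptotics.
Variable R : realType.

Lemma ln_sqr_le (x : R) (a : nat) : 1 <= x -> (0 < a)%N -> x <= a.+1%:R ^+ 6 ->
  ln x ^+ 2 <= 288 * a%:R.
Proof.
move=> x1 a0 hx; have x0 : 0 < x by lra.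
have lx : 0 <= ln x by apply: ln_ge0.
have [q q0 eq] : exists2 q : R, 0 < q & q ^+ 2 = a.+1%:R.
  by exists (Num.sqrt a.+1%:R); rewrite ?sqrtr_gt0 ?sqr_sqrtr ?ltr0n.
have h : ln x <= 12 * q.
  apply: le_trans (_ : ln (a.+1%:R ^+ 6) <= _).
    by rewrite ler_ln ?posrE ?exprn_gt0 ?ltr0n.
  rewrite -eq -exprM lnXn // mulr_natl lerMn2r /=.
  exact/ltW/ln_sublinear.
apply: le_trans (_ : (12 * q) ^+ 2 <= _).
  by rewrite lerXn2r ?nnegrE // mulr_ge0 // ltW.
have a1 : (1 : R) <= a%:R by rewrite ler1n.
rewrite exprMn eq -natr1; lra.
Qed.

Lemma multiplier_size (x K : R) (N a b M : nat) : 8 <= x -> 0 <= K ->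
  (0 < a)%N -> N%:R <= x -> x <= a.+1%:R ^+ 6 -> (a ^ 6 <= N)%N -> (0 < b)%N ->
  (a * b <= 4 * N)%N ->
  ln (M%:R : R) <= (b.*2)%:R * ln (b.*2)%:R + K * a%:R ^+ 5 * ln (N.*2.+2)%:R ->
  ln (M%:R : R) <= (4608 + 576 * K) * (x / ln x).
Proof.
move=> x8 K0 a0 Nx hx aN b0 ab hM.
have x1 : 1 <= x by lra.
have L0 : 0 < ln x by apply: ln_gt0; lra.
have L2 := ln_sqr_le x1 a0 hx.
have a1 : (1 : R) <= a%:R by rewrite ler1n.
have b1 : (1 : R) <= b%:R by rewrite ler1n.
have abx : a%:R * b%:R <= 4 * x.
  by apply: le_trans (_ : 4 * N%:R <= _); [rewrite -!natrM ler_nat | lra].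
have a6x : a%:R ^+ 6 <= x by apply: le_trans Nx; rewrite -natrX ler_nat.
have lnx2 (k : nat) : (0 < k)%N -> k%:R <= 8 * x -> ln (k%:R : R) <= 2 * ln x.
  move=> k0 hk; rewrite mulr_natl -lnXn; last by lra.
  rewrite ler_ln ?posrE ?exprn_gt0 ?ltr0n //; last by lra.
  by apply: le_trans hk _; rewrite expr2 ler_wpM2r //; lra.
have bx : b%:R <= 4 * x.
  by apply: le_trans abx; rewrite ler_peMl //; lra.
have l1 : ln ((b.*2)%:R : R) <= 2 * ln x.
  by apply: lnx2; rewrite ?double_gt0 // -muln2 natrM; lra.
have l2 : ln ((N.*2.+2)%:R : R) <= 2 * ln x.
  by apply: lnx2 => //; rewrite -addn2 -muln2 natrD natrM; lra.
apply: (le_trans hM); rewrite mulrA ler_pdivlMr // mulrDl mulrDl; apply: lerD.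
  apply: le_trans (_ : (4 * (b%:R * ln x)) * ln x <= _).
    rewrite ler_wpM2r ?(ltW L0) // -muln2 natrM.
    apply: le_trans (_ : b%:R * 2 * (2 * ln x) <= _); last by lra.
    by rewrite ler_wpM2l ?mulr_ge0 // -natrM muln2.
  rewrite -!mulrA -expr2 (mulrA 4).
  apply: le_trans (_ : 4 * b%:R * (288 * a%:R) <= _); last by lra.
  by rewrite ler_wpM2l // mulr_ge0.
apply: le_trans (_ : K * a%:R ^+ 5 * (2 * ln x) * ln x <= _).
  by rewrite ler_wpM2r ?(ltW L0) // ler_wpM2l // mulr_ge0 ?exprn_ge0.
rewrite (_ : K * _ * _ * _ = K * (a%:R ^+ 5 * (2 * ln x ^+ 2))); last by ring.
apply: le_trans (_ : K * (a%:R ^+ 5 * (2 * (288 * a%:R))) <= _).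
  by apply: ler_wpM2l => //; apply: ler_wpM2l; [exact: exprn_ge0 | lra].
rewrite (_ : K * _ = 576 * K * a%:R ^+ 6); last by ring.
have K576 : 0 <= 576 * K by lra.
exact: (ler_wpM2l K576 a6x).
Qed.

Lemma poly_le_expR (D M B y e : R) : 1 <= D -> 0 < M -> ln M <= B * y -> 1 <= y ->
  0 <= e -> D * M ^+ 4 <= expR (e + (ln D + 4 * B) * y).
Proof.
move=> D1 M0 hM y1 e0; have D0 : 0 < D by lra.
have M40 : 0 < M ^+ 4 by rewrite exprn_gt0.
rewrite -[leLHS]lnK ?posrE ?mulr_gt0 // ler_expR lnM ?posrE // lnXn //.
have : ln D <= ln D * y by rewrite ler_peMr ?ln_ge0.
move: hM; move: (ln D) (ln M) => d m hm hd; lra.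
Qed.

Lemma affine_height_le (H c h m : R) : 0 <= H -> 0 <= c -> 1 <= m -> h <= H * m ->
  h / 2 + c <= (H + c + 1) * m.
Proof.
move=> H0 c0 m1 hm; have : 0 <= c * (m - 1) by rewrite mulr_ge0 ?subr_ge0.
have : 0 <= H * m by rewrite mulr_ge0 //; lra.
lra.
Qed.

End Asymptotics.

Lemma box_size (N a : nat) : (8 <= N)%N -> (a <= N)%N ->
  (a * ((N + 2) %/ a).+1 <= 4 * N)%N.
Proof. by rewrite mulnS mulnC; have := leq_trunc_div (N + 2) a; lia. Qed.

Theorem theorem5 (R : realType) (E : weierstrass int) (r s : nat)
    (Gamma : set (ecpoint (base_change rat E))) :
  minimal_elliptic E ->
  has_rank [set: ecpoint (base_change rat E)] r -> (2 <= r)%N ->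
  subgroup Gamma -> has_rank Gamma s -> (1 <= s)%N -> (s < r)%N ->
  exists C : R, \forall x \near +oo, exists Q : ecpoint (base_change rat E),
    canonical_height R Q <= expR (4 / (s%:R + 2) * x + C * (x / ln x)) /\
    pseudolinearly_dependent Gamma x Q.
Proof.
move=> [dE _] rkE _ sG rkG s1 sr.
have dW : disc (base_change rat E) != 0 by rewrite disc_base_change intr_eq0.
have [P hP] := rank_lt_free dW rkE rkG sr.
have [P0 GP0 ntP0] : exists2 P0 : ecgroup dW, Gamma P0 &
    forall k, (0 < k)%N -> P0 *+ k != 0.
  have [[B [GB ind]] _] := rkG; exists (B (Ordinal s1)); first exact: GB.
  by move=> k k0; apply: (independent_nontorsion (P := B) _ ind).
have [K K0 hK] := multiplier R P sG GP0 ntP0.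
have [H H0 hH] := lheight_mul R P.
have [c c0 hc] := canonical_height_le R dW.
pose D := H + c + 1; have D1 : 1 <= D by rewrite /D; lra.
exists (ln D + 4 * (4608 + 576 * K)).
near=> x.
have x8 : 8 <= x by near: x; apply: nbhs_pinfty_ge; rewrite num_real.
pose N := Num.truncn x.
have /andP[Nx xN] : N%:R <= x < N.+1%:R by apply: truncn_itv; lra.
have N8 : (8 <= N)%N by rewrite /N truncn_ge_nat //; lra.
have [a /andP[aN Na]] := sixth_root N.
have a0 : (0 < a)%N by case: a aN Na => // _; rewrite exp1n => /(leq_ltn_trans N8).
have aN1 : (a <= N)%N.
  by apply: leq_trans aN; rewrite expnS leq_pmulr // expn_gt0 a0.
pose b := ((N + 2) %/ a).+1.
have hab : (N.+1 < a * b)%N by rewrite /b mulnC; apply: leq_trans (ltn_ceil _ a0); rewrite addn2.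
have ab4 : (a * b <= 4 * N)%N.
  exact: box_size.
have [M [M0 hM lnM]] := hK N a b hab.
have xa : x <= a.+1%:R ^+ 6.
  by apply: ltW; apply: lt_le_trans xN _; rewrite -natrX ler_nat.
have lnMx := multiplier_size x8 K0 a0 Nx xa aN (ltn0Sn _) ab4 lnM.
have L0 : 0 < ln x by apply/ln_gt0/(lt_le_trans _ x8); rewrite ltr1n.
have xL1 : 1 <= x / ln x by rewrite ler_pdivlMr // mul1r; apply/ltW/ln_sublinear/(lt_le_trans _ x8).
exists (P *+ M); split; last split.
- apply: le_trans (hc _) _; apply: le_trans (affine_height_le H0 c0 _ (hH M)) _.
    by rewrite exprn_ege1 // ler1n.
  apply: poly_le_expR => //; first by rewrite ltr0n.
  by rewrite mulr_ge0 ?(le_trans _ x8) // divr_ge0 // addr_ge0.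
- exact: hP.
move=> p pr px gp; apply: hM => //.
by rewrite truncn_ge_nat //; lra.
Unshelve. all: by end_near.
Qed.
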